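(* Let $\mathbb{K}$ be a field, let $G$ be a chordal graph, and let $t \ge 2$ be an integer. The following are equivalent: (a) The $t$-connected ideal $J_t(G) \subset \mathbb{K}[G]$ has linear quotients. (b) $J_t(G)$ has a linear resolution. (c) $G$ is $t$-gap-free.
   Context: Graphs are finite and simple. A graph is chordal if it contains no induced subgraph isomorphic to a cycle on four or more vertices. For $C \subset V(G)$, $G[C]$ is the induced subgraph on $C$; $C$ is connected if $G[C]$ is connected, and $t$-connected if moreover $|C| = t$. $\mathbb{K}[G]$ is the polynomial ring over $\mathbb{K}$ in the variables $\{x_v : v \in V(G)\}$, and for $C \subset V(G)$ put $x_C = \prod_{c\in C} x_c$. For $t \ge 2$, the $t$-connected ideal is $J_t(G) = \langle x_C : C \subset V(G) \text{ is } t\text{-connected}\rangle \subset \mathbb{K}[G]$. A monomial ideal $I$ with minimal monomial generating set $\operatorname{mingens}(I)$ has linear quotients if there is an order $u_1 < \cdots < u_m$ on $\operatorname{mingens}(I)$ such that for each $i = 2,\dots,m$ the colon ideal $\langle u_1,\dots,u_{i-1}\rangle : \langle u_i\rangle$ is generated by a subset of the variables. The zero ideal is considered to have linear quotients. A homogeneous ideal $I$ of a polynomial ring (standard grading) generated by its degree $t$ elements has a linear resolution if its graded Betti numbers satisfy $\beta_{i,j}(I) = 0$ for all $j \ne i + t$. The zero ideal is also said to have a linear resolution. Let $\mathcal{H}(G,t)$ be the hypergraph with vertex set $V(G)$ and hyperedges the $t$-connected subsets of $V(G)$. A matching in a hypergraph is a set of pairwise disjoint hyperedges; a matching $\{E_1,\dots,E_s\}$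 is induced if every hyperedge $E \subset E_1 \sqcup \cdots \sqcup E_s$ equals some $E_i$. The induced matching number $\gamma(\mathcal{H})$ is the maximum cardinality of an induced matching in $\mathcal{H}$. $G$ is $t$-gap-free if $\gamma(\mathcal{H}(G,t)) \le 1$. *)

(* Defs.v *)
From mathcomp Require Import all_boot all_order all_algebra.
From mathcomp Require Import mpoly.

Set Implicit Arguments.
Unset Strict Implicit.
Unset Printing Implicit Defensive.

Import GRing.Theory.
Local Open Scope ring_scope.

(* A finite simple graph on V is a symmetric irreflexive e : rel V. *)
Section Graphs.
Variables (V : finType) (e : rel V).

Definition cycle_rel (k : nat) : rel 'I_k :=
  fun i j => (j == ordS i) || (i == ordS j).

Definition has_induced_subgraph (U : finType) (h : rel U) : Prop :=
  exists2 f : U -> V, injective f & forall x y, e (f x) (f y) = h x y.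

Definition chordal : Prop :=
  forall k : nat, (4 <= k)%N -> ~ has_induced_subgraph (@cycle_rel k).

Definition induced (C : {set V}) : rel V :=
  fun x y => [&& x \in C, y \in C & e x y].

Definition connected_set (C : {set V}) : bool :=
  [forall x in C, forall y in C, connect (induced C) x y].

Definition tconnected (t : nat) (C : {set V}) : bool :=
  (#|C| == t) && connected_set C.

End Graphs.

(* A hypergraph on V is given by its set of hyperedges. *)
Section Hypergraphs.
Variable V : finType.
Implicit Types H M : {set {set V}}.

Definition matching H M : bool := (M \subset H) && trivIset M.

Definition induced_matching H M : bool :=
  matching H M && [forall E in H, (E \subset cover M) ==> (E \in M)].

Definition induced_matching_number H : nat :=
  \max_(M : {set {set V}} | induced_matching H M) #|M|.

Definition tconnected_hypergraph (e : rel V) (t : nat) : {set {set V}} :=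
  [set C | tconnected e t C].

Definition tgap_free (e : rel V) (t : nat) : Prop :=
  (induced_matching_number (tconnected_hypergraph e t) <= 1)%N.

End Hypergraphs.

(* Ideals are Prop-valued predicates on the polynomial ring. *)
Section Ideals.
Variables (K : fieldType) (n : nat).
Local Notation S := {mpoly K[n]}.

Definition ideal_gen (gens : S -> Prop) (p : S) : Prop :=
  exists2 s : seq (S * S),
    (forall c, c \in s -> gens c.2) & p = \sum_(c <- s) c.1 * c.2.

Definition monomial_ideal (u : seq 'X_{1..n}) : S -> Prop :=
  ideal_gen (fun q => exists2 m, m \in u & q = 'X_[m]).

Definition variables_ideal (A : {set 'I_n}) : S -> Prop :=
  ideal_gen (fun q => exists2 k, k \in A & q = 'X_k).

Definition colon (I J : S -> Prop) : S -> Prop :=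
  fun p => forall q, J q -> I (p * q).

Definition same_ideal (I J : S -> Prop) : Prop := forall p, I p <-> J p.

(* u lists, without repetition, an inclusion-minimal set of monomials
   generating I. *)
Definition is_mingens (I : S -> Prop) (u : seq 'X_{1..n}) : Prop :=
  [/\ uniq u,
      same_ideal I (monomial_ideal u)
    & forall v : seq 'X_{1..n}, {subset v <= u} ->
        same_ideal I (monomial_ideal v) -> {subset u <= v}].

(* The sequence u is 0-indexed: u_i is nth 0%MM u (i - 1).  The zero ideal
   satisfies this with u empty. *)
Definition has_linear_quotients (I : S -> Prop) : Prop :=
  exists2 u : seq 'X_{1..n}, is_mingens I u &
    forall i : nat, (0 < i < size u)%N ->
      exists A : {set 'I_n},
        same_ideal (colon (monomial_ideal (take i u))
                          (monomial_ideal [:: nth 0%MM u i]))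
                   (variables_ideal A).

(* Graded free S-modules F_i with basis indexed by 'I_(rk i), the basis
   element a having degree shift a, i.e. F_i = \bigoplus_a S(- shift a).
   Elements are row vectors; maps act by right multiplication:
   bdry i : F_(i+1) -> F_i and aug : F_0 -> S. *)
Record free_sequence := FreeSequence {
  rk : nat -> nat;
  shift : forall i, 'I_(rk i) -> nat;
  bdry : forall i, 'M[S]_(rk i.+1, rk i);
  aug : 'cV[S]_(rk 0)
}.

(* The maps preserve degrees. *)
Definition graded_maps (F : free_sequence) : Prop :=
  [/\ forall a, aug F a 0 \is (shift a).-homog,
      forall i (a : 'I_(rk F i.+1)) (b : 'I_(rk F i)),
        (shift b <= shift a)%N -> bdry F i a b \is (shift a - shift b).-homog
    & forall i (a : 'I_(rk F i.+1)) (b : 'I_(rk F i)),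
        (shift a < shift b)%N -> bdry F i a b = 0].

(* ... -> F_1 -> F_0 -> I -> 0 is exact. *)
Definition resolves (F : free_sequence) (I : S -> Prop) : Prop :=
  [/\ forall p, I p <-> exists v : 'rV[S]_(rk F 0), p = (v *m aug F) 0 0,
      forall v : 'rV[S]_(rk F 0),
        v *m aug F = 0 <-> exists w, v = w *m bdry F 0
    & forall i (v : 'rV[S]_(rk F i.+1)),
        v *m bdry F i = 0 <-> exists w, v = w *m bdry F i.+1].

(* The image of F_(i+1) lies in (x_1, ..., x_n) F_i. *)
Definition minimal_maps (F : free_sequence) : Prop :=
  forall i a b, variables_ideal [set: 'I_n] (bdry F i a b).

Definition minimal_graded_free_resolution (F : free_sequence)
    (I : S -> Prop) : Prop :=
  [/\ graded_maps F, resolves F I & minimal_maps F].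

(* beta i j is the number of basis elements of degree j in the i-th module of
   a minimal graded free resolution of I.  For homogeneous I such a resolution
   exists and is unique up to isomorphism, so beta is determined by I. *)
Definition graded_betti_numbers (I : S -> Prop) (beta : nat -> nat -> nat) :
    Prop :=
  exists2 F : free_sequence, minimal_graded_free_resolution F I &
    forall i j, beta i j = #|[set a : 'I_(rk F i) | shift a == j]|.

(* For the zero ideal beta = 0, so the condition holds for every t. *)
Definition has_linear_resolution (t : nat) (I : S -> Prop) : Prop :=
  exists2 beta, graded_betti_numbers I beta &
    forall i j : nat, j <> (i + t)%N -> beta i j = 0%N.

End Ideals.

(* The variable x_v is 'X_(enum_rank v). *)
Definition vset_monomial (K : fieldType) (V : finType) (C : {set V}) :
    {mpoly K[#|V|]} :=
  \prod_(c in C) 'X_(enum_rank c).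

Definition tconnected_ideal (K : fieldType) (V : finType) (e : rel V)
    (t : nat) : {mpoly K[#|V|]} -> Prop :=
  ideal_gen (fun p => exists2 C, tconnected e t C & p = vset_monomial K C).

Arguments tconnected_ideal K {V} e t _.

(* Main.v *)
Require Import Defs.
From mathcomp Require Import all_boot all_order all_algebra.
From mathcomp Require Import zify.
From mathcomp Require mpoly.
From Stdlib Require Import ClassicalEpsilon.

(** (a) => (b).  If a module generated by [f_1, ..., f_m] has colon ideals
    [<f_1, ..., f_(j-1)> : f_j = (x_k : k in A_j)], then its syzygy module is
    generated by elements [g_(j,k) = x_k e_j - (earlier terms)] for [k in A_j],
    and for the lexicographic order these have linear quotients again, with
    variable sets [{k' in A_j | k' < k}].  If the [f_j] are homogeneous of one
    degree, the [g_(j,k)] can be chosen linear, and iterating gives a linear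
    resolution.

    (b) => (c).  For an induced matching [{C, D}], the only t-connected sets in
    [C :|: D] are [C] and [D], so no linear syzygy contributes to the syzygy
    between [x_C] and [x_D].

    (c) => (a).  Gap-freeness means that any two t-connected sets meet or are
    adjacent.  Order them lexicographically along a perfect elimination order,
    where the last vertex is the most significant one.  If [C] comes before
    [D], some vertex of [C] outside [D] can be exchanged for the vertex of [D]
    that is eliminated first: the latter is simplicial, so removing it
    preserves connectedness. *)

Set Implicit Arguments.
Unset Strict Implicit.
Unset Printing Implicit Defensive.

(** * Connected sets *)

Section Connected.
Variables (V : finType) (e : rel V).
Hypothesis e_sym : symmetric e.
Implicit Types (A B C D W : {set V}) (u v w x y z : V).

(** If no edge leaves [A], it is closed under reachability in [C]; conversely, no edge leaves the
    set reachable from [x]. Cuts, unlike paths, restrict well to unions and deletions. *)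
Lemma connected_cutP C :
  connected_set e C <->
  forall A, A \subset C -> A != set0 -> C :\: A != set0 ->
    exists2 a, a \in A & exists2 b, b \in C :\: A & e a b.
Proof.
split=> [conC A sAC /set0Pn[x Ax] /set0Pn[y DAy] | cutC].
  have [/exists_inP[a Aa /exists_inP[b]]|/exists_inPn noedge] :=
    boolP [exists a in A, exists b in C :\: A, e a b]; first by exists a => //; exists b.
  have Ay : y \in A.
    rewrite -(@closed_connect _ (induced e C) (mem A) _ x y) //.
      move=> z t /and3P[Cz Ct ezt]; apply/idP/idP => [Az|At]; apply: contraT => nA.
        by have /exists_inPn/(_ t) := noedge z Az; rewrite !inE nA Ct ezt => /(_ isT).
      by have /exists_inPn/(_ z) := noedge t At; rewrite !inE nA Cz e_sym ezt => /(_ isT).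
    by move/forall_inP: conC => /(_ x (subsetP sAC x Ax))/forall_inP; apply; case/setDP: DAy.
  by move: DAy; rewrite inE Ay.
apply/forall_inP => x Cx; apply/forall_inP => y Cy.
pose A := [set z in C | connect (induced e C) x z].
have sAC : A \subset C by apply/subsetP => z; rewrite inE => /andP[].
have Ax : x \in A by rewrite inE Cx connect0.
apply: contraT => nxy.
have [|| a] := cutC A sAC; first by apply/set0Pn; exists x.
  by apply/set0Pn; exists y; rewrite !inE Cy (negbTE nxy).
rewrite inE => /andP[Ca xa] [b]; rewrite !inE => /andP[+ Cb] eab.
rewrite Cb (connect_trans xa) //; apply: connect1.
by rewrite /induced Ca Cb.
Qed.

Lemma connected_set1 v : connected_set e [set v].
Proof.
by apply/forall_inP => x /set1P->; apply/forall_inP => y /set1P->; apply: connect0.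
Qed.

(** A cut splitting neither [C] nor [D] separates them, and is then crossed by the edge between [x]
    and [y]. *)
Lemma connected_setU C D x y :
  connected_set e C -> connected_set e D -> x \in C -> y \in D ->
  (x == y) || e x y -> connected_set e (C :|: D).
Proof.
move=> /connected_cutP cutC /connected_cutP cutD Cx Dy exy.
apply/connected_cutP => A sA A0 nA0.
have cut (E : {set V}) : E \subset C :|: D ->
    (forall A, A \subset E -> A != set0 -> E :\: A != set0 ->
      exists2 a, a \in A & exists2 b, b \in E :\: A & e a b) ->
    [\/ exists2 a, a \in A & exists2 b, b \in (C :|: D) :\: A & e a b,
        A :&: E = set0 | E \subset A].
  move=> sE cutE; have [->|AE0] := eqVneq (A :&: E) set0; first by constructor 2.
  have [EA0|EA0] := eqVneq (E :\: A) set0.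
    by constructor 3; rewrite -setD_eq0 EA0.
  have [|a] := cutE (A :&: E) (subsetIr _ _) AE0.
    by rewrite setDIr setDv setU0.
  rewrite inE => /andP[Aa Ea] [b]; rewrite setDIr setDv setU0 => Eb eab.
  by constructor 1; exists a => //; exists b => //; move: b Eb {eab};
    apply/subsetP; apply: setSD.
case: (cut C (subsetUl _ _) cutC) => // hC;
  case: (cut D (subsetUr _ _) cutD) => // hD.
- case/negP: A0; apply/eqP/setP => z; rewrite inE; apply/negP => Az.
  have /setUP[Cz|Dz] := subsetP sA z Az.
    by have := in_set0 z; rewrite -hC inE Az Cz.
  by have := in_set0 z; rewrite -hD inE Az Dz.
- have Ay := subsetP hD y Dy; have nAx : x \notin A.
    by apply/negP => Ax; have := in_set0 x; rewrite -hC inE Ax Cx.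
  have /orP[/eqP xy|exy'] := exy; first by rewrite xy Ay in nAx.
  by exists y => //; exists x; rewrite 1?e_sym // !inE nAx Cx.
- have Ax := subsetP hC x Cx; have nAy : y \notin A.
    by apply/negP => Ay; have := in_set0 y; rewrite -hD inE Ay Dy.
  have /orP[/eqP xy|exy'] := exy; first by rewrite -xy Ax in nAy.
  by exists x => //; exists y; rewrite // !inE nAy Dy orbT.
- by case/negP: nA0; rewrite setD_eq0 subUset hC hD.
Qed.

(** Relative to a vertex set, so that inductions can shrink [W] while the graph stays fixed. *)
Definition simplicial_in W z : Prop :=
  z \in W /\
  forall x y, x \in W -> y \in W -> e z x -> e z y -> x != y -> e x y.

(** Were a cut [A] of [C :\ z] crossed by no edge, [z] would have neighbours on both sides of it,
    and these are adjacent because [z] is simplicial. *)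
Lemma connected_setD1_simplicial C z :
  connected_set e C -> simplicial_in C z -> connected_set e (C :\ z).
Proof.
move=> /connected_cutP cutC [Cz simpz].
apply/connected_cutP => A sA A0 nA0.
have [/exists_inP[a Aa /exists_inP[b]]|/exists_inPn noedge] :=
  boolP [exists a in A, exists b in C :\ z :\: A, e a b]; first by exists a => //; exists b.
have {}noedge a b : a \in A -> b \in C :\ z :\: A -> ~~ e a b.
  by move=> Aa; have /exists_inPn := noedge a Aa; apply.
have nAz : z \notin A by apply/negP => /(subsetP sA); rewrite !inE eqxx.
have sAC : A \subset C := subset_trans sA (subsetDl _ _).
have [|||a] := cutC (z |: A); first by rewrite subUset sub1set Cz.
- by apply/set0Pn; exists z; rewrite setU11.
- by rewrite -setDDl.
move=> zAa [b]; rewrite -setDDl => CAb eab.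
have ezb : e z b.
  by move: zAa; rewrite 2!inE => /orP[/eqP <- //|/noedge/(_ CAb)]; rewrite eab.
have [//||a' Aa' [b']] := cutC A sAC.
  by apply/set0Pn; exists z; rewrite inE nAz Cz.
move=> CAb' ea'b'.
have [b'z|b'z] := eqVneq b' z; last first.
  by have := noedge a' b' Aa'; rewrite ea'b' inE; move: CAb';
    rewrite !inE b'z => /andP[->->] /(_ isT).
have Cb : b \in C by move: CAb; rewrite !inE => /and3P[].
case/negP: (noedge a' b Aa' CAb).
apply: simpz => //; first exact: (subsetP sAC).
  by rewrite e_sym -b'z.
by apply: contraTneq CAb => <-; rewrite !inE Aa'.
Qed.

(** * Chordal graphs *)

(** Minimality of the length excludes repetitions and forward chords: either would give a shorter
    path. *)
Lemma shortest_path (T : finType) (r : rel T) (x y : T) :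
  connect r x y -> exists p, [/\ path r x p, last x p = y, uniq (x :: p) &
    forall i j, i < j <= size p ->
      r (nth x (x :: p) i) (nth x (x :: p) j) -> j = i.+1].
Proof.
move=> /connectP[p0 p0P ylast].
pose P k := [exists p : k.-tuple T, path r x p && (last x p == y)].
have exP : exists k, P k.
  by exists (size p0); apply/existsP; exists (in_tuple p0); rewrite p0P ylast /=.
case: (ex_minnP exP) => k /existsP[p /andP[pP /eqP plast]] kmin.
have {kmin} pmin q : path r x q -> last x q = y -> size p <= size q.
  move=> qP qlast; rewrite size_tuple; apply: kmin.
  by apply/existsP; exists (in_tuple q); rewrite qP qlast /=.
exists p; split=> //.
  case: (shortenP pP) (plast) => p' p'P p'uniq p'sub p'last.
  have sz := pmin _ p'P p'last.
  apply: leq_size_uniq p'uniq _ _ => //.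
  by move=> z; rewrite !inE => /orP[->//|/p'sub ->]; rewrite orbT.
move=> i [|j] /andP[ij jp] //= rij; apply/eqP; rewrite eqSS eqn_leq [i <= j]ij andbT.
rewrite leqNgt; apply/negP => ltij.
have jp' : j < size p by [].
have lasti : last x (take i p) = nth x (x :: p) i.
  by case: (i) ltij => [|i'] ltij; rewrite ?take0 //=
    (last_nth x) size_takel /= ?nth_take //; lia.
suff: size p <= size (take i p ++ drop j p).
  by rewrite size_cat size_drop size_takel; lia.
have pd : path r (nth x p j) (drop j.+1 p).
  by move: pP; rewrite -{1}(cat_take_drop j p) cat_path (drop_nth x jp') /= => /and3P[].
apply: pmin.
  rewrite cat_path lasti (drop_nth x jp') /= pd rij !andbT.
  by move: pP; rewrite -{1}(cat_take_drop i p) cat_path => /andP[].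
have := congr1 (last x) (cat_take_drop j p).
by rewrite !last_cat (drop_nth x jp') /= plast.
Qed.

Hypothesis e_irr : irreflexive e.

(* A shortest path from [s] to [s'] avoiding [v] and its other neighbours
   closes up with [v] to a chordless cycle. *)
Lemma chordal_common_neighbour (U : {set V}) v s s' :
  chordal e -> s != s' -> e v s -> e v s' ->
  (forall u, u \in U -> ~~ e v u) ->
  v \notin U -> connect (induced e (s |: (s' |: U))) s s' -> e s s'.
Proof.
move=> chord ss' evs evs' Unv nUv; apply: contraTT => ness'.
apply/negP => /shortest_path[p [pP plast puniq chordless]].
have sz : 1 < size p.
  case: p pP plast {puniq chordless} => [|b [|//]] /= pP plast.
    by rewrite plast eqxx in ss'.
  by move: pP; rewrite plast /induced (negbTE ness') !andbF.
set X := s |: _ in pP chordless.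
have pX : all [in X] (s :: p).
  rewrite /= setU11 /=; elim: (p) (s) pP => //= b q IH a /andP[/and3P[_ Xb _]].
  by rewrite Xb; apply: IH.
set q := s :: p in puniq chordless pX.
have szq : size q = (size p).+1 by [].
have qX i : i < size q -> nth s q i \in X by move=> lti; apply: (allP pX); apply: mem_nth.
have q0 : nth s q 0 = s by [].
have ql : nth s q (size p) = s' by rewrite -plast (last_nth s).
have nXv : v \notin X.
  by rewrite !inE !negb_or nUv andbT; apply/andP; split;
     [apply: contraTneq evs => -> | apply: contraTneq evs' => ->]; rewrite e_irr.
have evq i : i < size q -> e v (nth s q i) = (i == 0) || (i == size p).
  move=> lti; have [->|i0] := eqVneq i 0; first by rewrite q0 evs.
  have [->|il] := eqVneq i (size p); first by rewrite ql evs'.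
  have := qX i lti; rewrite !in_setU1 => /or3P[/eqP h|/eqP h|/Unv/negbTE//].
    by have := nth_uniq s lti (isT : 0 < size q) puniq; rewrite q0 h eqxx (negbTE i0).
  have := nth_uniq s lti (leqnn _ : size p < size q) puniq.
  by rewrite ql h eqxx (negbTE il).
have eqq i j : (i < j < size q)%N -> e (nth s q i) (nth s q j) = (j == i.+1).
  move=> /andP[ij lt]; apply/idP/eqP => [eij|ji]; last rewrite ji in lt *.
    apply: chordless; first by rewrite ij.
    by rewrite /induced eij !qX ?(ltn_trans ij).
  by have /(pathP s)/(_ i) := pP; rewrite -ltnS -szq lt => /(_ isT)/and3P[].
(* The cycle starts at [v] and runs along the path; [v] sees only the two ends of the path. *)
pose k := (size q).+1; pose f (i : 'I_k) := nth v (v :: q) i.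
have ksz : k = (size p).+2 by [].
apply: (chord k); first by rewrite ksz !ltnS.
have nthq i : i < size q -> nth v q i = nth s q i by apply: set_nth_default.
have half (i j : 'I_k) : i <= j -> e (f i) (f j) = cycle_rel i j.
  case: i j => [i lti] [j ltj] /= ij; rewrite /f /cycle_rel -!val_eqE /=.
  case: i lti ij => [|i] lti ij; case: j ltj ij => [|j] ltj ij //=.
  - rewrite nthq // evq // modn_small ?eqSS //; congr orb.
    have [jl|jl] := eqVneq j (size p); first by rewrite jl -ksz modnn.
    by rewrite modn_small //; move: ltj; rewrite ksz; lia.
  rewrite !nthq //.
  have -> : (i.+1 == j.+2 %% k) = false.
    have [jk|jk] := eqVneq j.+2 k; first by rewrite jk modnn.
    by rewrite modn_small; [lia|move: ltj; rewrite ksz; lia].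
  rewrite orbF; have [ji|ji] := eqVneq i j.
    rewrite -ji e_irr; have [jk|jk] := eqVneq i.+2 k; first by rewrite jk modnn.
    by rewrite modn_small; [lia|move: lti; rewrite ksz; lia].
  have ltij : i < j by rewrite ltn_neqAle ji.
  by rewrite eqq ?ltij // modn_small //; move: ltj; rewrite ksz; lia.
have vq_uniq : uniq (v :: q).
  by rewrite cons_uniq puniq andbT; apply: contra nXv => qv; apply: (allP pX).
exists f => [i j /eqP|i j].
  by rewrite /f nth_uniq // => /eqP/val_inj.
have [ij|/ltnW ij] := leqP i j; first exact: half.
by rewrite e_sym half // /cycle_rel orbC.
Qed.

(* Dirac's argument: the neighbourhood [S] of a component [B] of the
   non-neighbours of [v] is a clique, so that a simplicial vertex of [B :|: S]
   lying in [B] is simplicial in [W]. *)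
Lemma chordal_simplicial_nonneighbour W v :
  chordal e -> v \in W -> (exists2 u, u \in W & (u != v) && ~~ e v u) ->
  exists2 z, simplicial_in W z & (z != v) && ~~ e v z.
Proof.
move=> chord; have [n] := ubnP #|W|; elim: n => // n IH in W v *.
rewrite ltnS => leW Wv [u Wu uv].
pose U := [set x in W | (x != v) && ~~ e v x].
have Uu : u \in U by rewrite inE Wu.
pose B := [set x in U | connect (induced e U) u x].
pose S := [set s in W | e v s && [exists b in B, e s b]].
have inB x : (x \in B) = (x \in U) && connect (induced e U) u x by rewrite [LHS]inE.
have BU : {subset B <= U} by move=> x; rewrite inE => /andP[].
have nUv : v \notin U by rewrite !inE eqxx andbF.
have UN x : x \in U -> ~~ e v x by rewrite inE => /and3P[].
have S_clique s s' : s \in S -> s' \in S -> s != s' -> e s s'.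
  rewrite [s \in S]inE [s' \in S]inE => /and3P[Ws evs /exists_inP[b Bb esb]].
  move=> /and3P[Ws' evs' /exists_inP[b' Bb' esb']] ss'.
  apply: (@chordal_common_neighbour U v) => //.
  set X := s |: _.
  have UX : {subset U <= X} by move=> x Ux; rewrite !in_setU1 Ux !orbT.
  have Xs : s \in X by rewrite setU11.
  have Xs' : s' \in X by rewrite !in_setU1 eqxx orbT.
  apply: (@connect_trans _ _ b).
    by apply: connect1; rewrite /induced Xs esb UX ?BU.
  apply: (@connect_trans _ _ b'); last first.
    by apply: connect1; rewrite /induced Xs' e_sym esb' UX ?BU.
  apply: (@connect_sub _ (induced e U)).
    move=> x y /and3P[Ux Uy exy]; apply: connect1.
    by rewrite /induced !UX.
  have symU : connect_sym (induced e U).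
    by apply: sym_connect_sym => x y; rewrite /induced e_sym andbCA.
  move: Bb Bb'; rewrite !inB => /andP[_ ub] /andP[_ ub'].
  by apply: connect_trans ub'; rewrite symU.
pose H := B :|: S.
have HW : H \subset W.
  by apply/subsetP => x; rewrite !inE => /orP[/andP[/andP[]]|/andP[]].
have nHv : v \notin H by rewrite inE negb_or (contra (@BU v)) // inE e_irr andbF.
have ltH : #|H| < n.
  apply: leq_trans leW; apply: proper_card; apply/properP; split=> //.
  by exists v.
have Bu : u \in B by rewrite inE Uu connect0.
have NB b x : b \in B -> x \in W -> e b x -> x \in H.
  move=> Bb Wx ebx; have Ub := BU b Bb; rewrite in_setU.
  have [Ux|nUx] := boolP (x \in U).
    apply/orP; left; rewrite inB Ux /=; move: Bb; rewrite inB => /andP[_ ub].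
    by apply: connect_trans ub (connect1 _); rewrite /induced Ub Ux.
  apply/orP; right; rewrite inE Wx /=; apply/andP; split; last first.
    by apply/exists_inP; exists b; rewrite // e_sym.
  move: nUx; rewrite inE Wx /= negb_and !negbK => /orP[/eqP xv|//].
  by have := UN b Ub; rewrite -xv e_sym ebx.
have conclude z : simplicial_in H z -> z \in B ->
    exists2 z, simplicial_in W z & (z != v) && ~~ e v z.
  move=> [Hz sz] Bz; exists z; last by move: (BU z Bz); rewrite inE => /andP[].
  split=> [|x y Wx Wy ezx ezy]; first exact: (subsetP HW).
  by apply: sz => //; apply: (NB z).
have HB z : z \in H -> z \notin S -> z \in B by rewrite inE => /orP[|->].
(* If some [s] in [S] misses a vertex of [H], induction on [H] gives a simplicial vertex not
   adjacent to [s], hence outside the clique [S]. *)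
have [/exists_inP[s Ss /exists_inP[x Hx xs]]|] :=
    boolP [exists s in S, exists x in H, (x != s) && ~~ e s x].
  have [|z simz /andP[zs esz]] := IH H s ltH _ (ex_intro2 _ _ x Hx xs).
    by rewrite inE Ss orbT.
  apply: (conclude z simz); apply: HB; first by case: simz.
  by apply: contra esz => Sz; apply: S_clique; rewrite // eq_sym.
move=> /exists_inPn univ.
have {}univ s x : s \in S -> x \in H -> x != s -> e s x.
  move=> Ss Hx xs; have /exists_inPn/(_ x Hx) := univ s Ss.
  by rewrite xs /= negbK.
have Hu : u \in H by rewrite inE Bu.
(* Now [S] is joined to all of [H], so a vertex not adjacent to some [b] in [B] again lies outside
   [S]. *)
have [/exists_inP[b Bb /exists_inP[x Hx xb]]|] :=
    boolP [exists b in B, exists x in H, (x != b) && ~~ e b x].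
  have [|z simz /andP[zs esz]] := IH H b ltH _ (ex_intro2 _ _ x Hx xb).
    by rewrite inE Bb.
  apply: (conclude z simz); apply: HB; first by case: simz.
  apply: contra esz => Sz; rewrite e_sym; apply: univ => //.
    by rewrite inE Bb.
  by rewrite eq_sym.
(* Otherwise [H] is a clique and [u] itself is simplicial. *)
move=> /exists_inPn univB; apply: (conclude u) => //; split=> // x y Hx Hy _ _ xy.
have [Sx|nSx] := boolP (x \in S); first by apply: univ; rewrite // eq_sym.
have /exists_inPn/(_ y Hy) := univB x (HB x Hx nSx).
by rewrite eq_sym xy /= negbK.
Qed.

Lemma chordal_simplicial W :
  chordal e -> W != set0 -> exists z, simplicial_in W z.
Proof.
move=> chord /set0Pn[w Ww].
have [/exists_inP[v Wv /exists_inP[u Wu uv]]|/exists_inPn compl] :=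
    boolP [exists v in W, exists u in W, (u != v) && ~~ e v u].
  have [|z simz _] := @chordal_simplicial_nonneighbour W v chord Wv.
    by exists u.
  by exists z.
exists w; split=> // x y Wx Wy _ _ xy.
by have /exists_inPn/(_ y Wy) := compl x Wx; rewrite eq_sym xy /= negbK.
Qed.

(* Vertices are eliminated in increasing order of [q]. *)
Definition perfect_elimination (q : V -> nat) : Prop :=
  injective q /\ forall x y z, q z < q x -> q z < q y ->
    e z x -> e z y -> x != y -> e x y.

Lemma chordal_perfect_elimination :
  chordal e -> exists q, perfect_elimination q.
Proof.
move=> chord.
(* Generalised to any vertex set, for induction: a simplicial vertex gets rank 0 and the others move
   up. *)
suff [q [injq peq]] : exists q : V -> nat, {in [set: V] &, injective q} /\
    {in [set: V] & &, forall x y z, q z < q x -> q z < q y ->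
      e z x -> e z y -> x != y -> e x y}.
  by exists q; split=> [x y|x y z]; [apply: injq|apply: peq]; rewrite inE.
have [n] := ubnP #|[set: V]|; elim: n [set: V] => // n IH W leW.
have [->|/(chordal_simplicial chord)[z [Wz simz]]] := eqVneq W set0.
  by exists (fun=> 0); split=> [x y|x y z]; rewrite inE.
have [|q [injq peq]] := IH (W :\ z); first by move: leW; rewrite (cardsD1 z) Wz.
exists (fun x => if x == z then 0 else (q x).+1); split=> [x y|x y w] Wx Wy.
  have [->|xz] := eqVneq x z; have [->|yz] := eqVneq y z => // -[].
  by apply: injq; rewrite !inE ?xz ?yz.
move=> Ww; have [->|wz] := eqVneq w z; first by move=> _ _; apply: simz.
have [//|xz] := eqVneq x z; have [//|yz] := eqVneq y z; rewrite !ltnS.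
by apply: peq; rewrite !inE ?xz ?yz ?wz.
Qed.

(** * The exchange property *)

Section Exchange.
Variable q : V -> nat.
Hypothesis q_pe : perfect_elimination q.

(** Deleting the earliest vertex of [C] keeps [C] connected, as that vertex is simplicial. Once [v]
    is the earliest, all its neighbours in [C] are later, and one exists because [u] remains. *)
Lemma connected_later_neighbour C v u :
  connected_set e C -> v \in C -> u \in C -> q v < q u ->
  exists2 w, w \in C & (q v < q w) && e v w.
Proof.
have [injq peq] := q_pe.
have [n] := ubnP #|C|; elim: n => // n IH in C *; rewrite ltnS => leC conC Cv Cu qvu.
case: (arg_minnP q Cv) => z Cz zmin.
have zlt x : x \in C -> x != z -> q z < q x.
  by move=> Cx xz; rewrite ltn_neqAle zmin // andbT; apply: contra xz => /eqP/injq->.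
have [vz|vz] := eqVneq v z.
  have /connected_cutP/(_ [set v]) := conC; rewrite sub1set => /(_ Cv).
  case=> [||a /set1P-> [b]]; first by apply/set0Pn; exists v; rewrite set11.
    by apply/set0Pn; exists u; rewrite !inE Cu andbT; apply: contraTneq qvu => ->; rewrite ltnn.
  rewrite !inE => /andP[bv Cb] evb; exists b => //.
  by rewrite evb andbT vz zlt // -vz.
have uz : u != z by apply: contraTneq qvu => ->; rewrite -leqNgt zmin.
have simz : simplicial_in C z.
  have later x : x \in C -> e z x -> q z < q x.
    by move=> Cx ezx; apply: zlt => //; apply: contraTneq ezx => ->; rewrite e_irr.
  by split=> // x y Cx Cy ezx ezy; apply: (peq _ _ z) => //; apply: later.
have [|||||w] := IH (C :\ z); last by rewrite inE => /andP[_ Cw] ?; exists w.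
- by move: leC; rewrite (cardsD1 z C) (Cz : z \in C).
- exact: connected_setD1_simplicial.
- by rewrite !inE vz.
- by rewrite !inE uz.
- by [].
Qed.

(* Comparing weights compares sets lexicographically, the vertex eliminated last
   being the most significant. *)
Definition weight C : nat := \sum_(c in C) 2 ^ q c.

Lemma weight_lt_pow C m : (forall c, c \in C -> q c < m) -> weight C < 2 ^ m.
Proof.
have [injq _] := q_pe.
elim: m C => [|m IH] C ltC.
  by rewrite /weight big1 // => c /ltC.
have [/exists_inP[c Cc /eqP qc]|/exists_inPn nC] := boolP [exists c in C, q c == m].
  have := IH (C :\ c); rewrite /weight (big_setD1 c Cc) /= qc expnS => lt.
  suff /lt : forall c', c' \in C :\ c -> q c' < m by lia.
  move=> c'; rewrite !inE => /andP[cc' /ltC]; rewrite ltnS leq_eqVlt -qc.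
  by case/orP => // /eqP/injq cc; rewrite cc eqxx in cc'.
have /leq_trans : weight C < 2 ^ m.
  by apply: IH => c Cc; have := ltC c Cc; rewrite ltnS leq_eqVlt (negbTE (nC c Cc)).
by apply; rewrite leq_pexp2l.
Qed.

(** Above [v] the two sums agree; the rest of [weight C] stays below [2 ^ q v], a term of
    [weight D]. *)
Lemma weight_lt C D v : v \in D -> v \notin C ->
  (forall x, q v < q x -> (x \in C) = (x \in D)) -> weight C < weight D.
Proof.
have [injq _] := q_pe; move=> Dv nCv agree.
rewrite /weight (bigID (fun c => q v < q c)) [X in _ < X](bigID (fun c => q v < q c)) /=.
rewrite (eq_bigl (fun c => (c \in D) && (q v < q c))); last first.
  by move=> c; apply: andb_id2r => /agree.
rewrite ltn_add2l.
have := @weight_lt_pow [set c in C | ~~ (q v < q c)] (q v).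
rewrite /weight (eq_bigl (fun c => (c \in C) && ~~ (q v < q c))); last by move=> c; rewrite inE.
move=> /(_ _)/leq_trans; apply.
  move=> c; rewrite inE -leqNgt leq_eqVlt => /andP[Cc /orP[/eqP/injq cv|//]].
  by rewrite cv (negbTE nCv) in Cc.
by rewrite (bigD1 v) ?Dv ?ltnn //= leq_addr.
Qed.

Lemma last_difference C D : C != D -> exists v,
  (v \in C) != (v \in D) /\ forall x, q v < q x -> (x \in C) = (x \in D).
Proof.
move=> CD.
have [x0 Dx0] : exists x, (x \in C) != (x \in D).
  apply/existsP; apply: contraNT CD => /existsPn eqCD.
  by apply/eqP/setP => x; have := eqCD x; rewrite negbK => /eqP.
case: (@arg_maxnP _ x0 (fun x => (x \in C) != (x \in D)) q Dx0) => v vCD vmax.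
exists v; split=> // x; apply: contraTeq => /vmax; by rewrite -leqNgt.
Qed.

Lemma weight_ltP C D : weight D < weight C ->
  exists v, [/\ v \in C, v \notin D & forall x, q v < q x -> (x \in C) = (x \in D)].
Proof.
move=> ltw; have [|v [vCD agree]] := @last_difference C D.
  by apply: contraTneq ltw => ->; rewrite ltnn.
exists v; have [Dv|nDv] := boolP (v \in D); last by rewrite (negbTE nDv) eqbF_neg negbK in vCD.
rewrite Dv eqb_id in vCD.
by have := weight_lt Dv vCD agree; rewrite ltnNge ltnW.
Qed.

Lemma weight_inj : injective weight.
Proof.
move=> C D eqw; apply/eqP; apply: contraT => /last_difference[v [vCD agree]].
have [Dv|nDv] := boolP (v \in D).
  by rewrite Dv eqb_id in vCD; have := weight_lt Dv vCD agree; rewrite eqw ltnn.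
rewrite (negbTE nDv) eqbF_neg negbK in vCD.
by have := weight_lt vCD nDv (fun x h => esym (agree x h)); rewrite eqw ltnn.
Qed.

(* The vertex [v] of [C] is attached to [D], either through a later neighbour
   in [C] that already lies in [D], or, when [C] reaches higher than [D],
   below the root of [D]; then the first vertex of [D] to be eliminated is
   simplicial and can be dropped. *)
Lemma connected_exchange C D :
  connected_set e C -> connected_set e D -> connected_set e (C :|: D) ->
  #|C| = #|D| -> weight D < weight C ->
  exists v w, [/\ v \in C, v \notin D, w \in D,
    connected_set e (v |: D :\ w) & weight D < weight (v |: D :\ w)].
Proof.
move=> conC conD conCD cardCD /weight_ltP[v [Cv nDv agree]].
have [injq peq] := q_pe.
have [w0 Dw0 nCw0] : exists2 w, w \in D & w \notin C.
  apply/subsetPn; apply: contra nDv => sDC.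
  by have/eqP-> : D == C by rewrite eqEcard sDC cardCD leqnn.
(* [w] is the first vertex of all of [D], possibly inside [C]; [w0] only bounds its rank. *)
case: (arg_minnP q Dw0) => w Dw wmin.
have wlt x : x \in D -> x != w -> q w < q x.
  by move=> Dx xw; rewrite ltn_neqAle wmin // andbT; apply: contra xw => /eqP/injq->.
have qwv : q w < q v.
  apply: leq_ltn_trans (wmin _ Dw0) _; rewrite ltn_neqAle.
  have [/injq w0v|_ /=] := eqVneq (q w0) (q v); first by rewrite w0v Cv in nCw0.
  by rewrite leqNgt; apply: contra nCw0 => /agree ->.
(* Such a [v'] suffices: [w] is first in [v' |: D], hence simplicial there, and the weight grows
   since [v'] is later than [w]. *)
suff [v' [Cv' nDv' [d Dd ev'd] qwv']] : exists v',
    [/\ v' \in C, v' \notin D, exists2 d, d \in D & e v' d & q w < q v'].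
  exists v', w; split=> //.
    have v'w : w != v' by apply: contraNneq nDv' => <-.
    have -> : v' |: D :\ w = (v' |: D) :\ w.
      by apply/setP => x; rewrite !inE; case: (eqVneq x w) => [->|]; rewrite ?(negbTE v'w).
    apply: connected_setD1_simplicial.
      by apply: (@connected_setU _ _ v' d) => //; rewrite ?connected_set1 ?set11 // ev'd orbT.
    split; first by rewrite inE (Dw : w \in D) orbT.
    have later x : x \in v' |: D -> e w x -> q w < q x.
      rewrite !inE => /orP[/eqP-> //|Dx ewx]; apply: wlt => //.
      by apply: contraTneq ewx => ->; rewrite e_irr.
    by move=> x y Dx Dy ewx ewy; apply: (peq _ _ w) => //; apply: later.
  apply: (@weight_lt _ _ v') => //; first by rewrite setU11.
  move=> x v'x; rewrite !inE.
  have -> : x == v' = false by apply: contraTF v'x => /eqP->; rewrite ltnn.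
  have -> : x != w by apply: contraTneq v'x => ->; rewrite -leqNgt ltnW.
  by [].
(* If [v] is not last in [C], its later neighbour in [C] lies in [D], as the sets agree above
   [v]. *)
have [/exists_inP[u Cu qvu]|/exists_inPn vmax] := boolP [exists u in C, q v < q u].
  have [d Cd /andP[qvd evd]] := connected_later_neighbour conC Cv Cu qvu.
  by exists v; split=> //; exists d; rewrite // -agree.
(* Otherwise the last vertex [d] of [D] comes before [v], and a later neighbour of [d] in [C :|: D]
   cannot lie in [D]. *)
case: (arg_maxnP q Dw0) => d Dd dmax.
have dlt : q d < q v.
  rewrite ltn_neqAle; have [/injq dv|_ /=] := eqVneq (q d) (q v).
    by rewrite -dv (Dd : d \in D) in nDv.
  rewrite leqNgt; apply/negP => qvd; have := vmax d; rewrite qvd agree // (Dd : d \in D).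
  by move=> /(_ isT).
have [||v' CDv' /andP[qdv' edv']] := @connected_later_neighbour _ d v conCD _ _ dlt.
- by rewrite inE (Dd : d \in D) orbT.
- by rewrite inE Cv.
have nDv' : v' \notin D by apply: contraTN qdv' => /dmax; rewrite -leqNgt.
exists v'; split=> //.
- by move: CDv'; rewrite inE (negbTE nDv') orbF.
- by exists d; rewrite // e_sym.
exact: leq_ltn_trans (wmin _ Dd) qdv'.
Qed.

End Exchange.

End Connected.

(** * Gap-freeness *)

Section GapFree.
Variables (V : finType) (e : rel V) (t : nat).
Hypothesis e_sym : symmetric e.
Hypothesis t_gt0 : 0 < t.
Implicit Types (C D E : {set V}).

Lemma tconnected_neq0 C : tconnected e t C -> C != set0.
Proof. by case/andP => /eqP cardC _; rewrite -card_gt0 cardC. Qed.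

(** Any two members of a large induced matching serve: a hyperedge inside their union belongs to the
    matching and meets one of them, hence equals it. *)
Lemma not_tgap_free : ~ tgap_free e t -> exists C D,
  [/\ tconnected e t C, tconnected e t D, [disjoint C & D] &
      forall E, tconnected e t E -> E \subset C :|: D -> E = C \/ E = D].
Proof.
move/negP; rewrite -ltnNge => gt1.
have [M indM ltM] : exists2 M, induced_matching (tconnected_hypergraph e t) M & 1 < #|M|.
  apply/exists_inP; apply: contraTT gt1 => /exists_inPn small.
  by rewrite -leqNgt; apply/bigmax_leqP => M /small; rewrite -leqNgt.
have [/andP[sMH trivM] /forall_inP indM'] := andP indM.
have [C [D [MC MD CD]]] := card_gt1P ltM.
have MH E : E \in M -> tconnected e t E by move=> /(subsetP sMH); rewrite inE.
exists C, D; split; [exact: MH|exact: MH| |].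
  exact: (trivIsetP trivM).
move=> E tE sE; have ME : E \in M.
  apply: (implyP (indM' E _)); first by rewrite inE.
  apply: subset_trans sE _; rewrite subUset.
  by rewrite !bigcup_sup.
have [x Ex] := set0Pn _ (tconnected_neq0 tE).
have eq_of F : F \in M -> x \in F -> E = F.
  move=> MF Fx; apply: contraTeq Fx => /(trivIsetP trivM _ _ ME MF)/disjointFr.
  by move=> ->.
by case/setUP: (subsetP sE x Ex) => Fx; [left|right]; apply: eq_of.
Qed.

(** If [C] and [D] neither met nor were adjacent, each t-connected set in their union would lie in
    one of them, making [[set C; D]] an induced matching. *)
Lemma tgap_free_connected_setU C D : tgap_free e t ->
  tconnected e t C -> tconnected e t D -> connected_set e (C :|: D).
Proof.
move=> gf tC tD; have [[_ conC] [_ conD]] := (andP tC, andP tD).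
have [x Cx] := set0Pn _ (tconnected_neq0 tC).
have [y Dy] := set0Pn _ (tconnected_neq0 tD).
have [/exists_inP[a Ca /exists_inP[b Db ab]]|/exists_inPn far] :=
  boolP [exists a in C, exists b in D, (a == b) || e a b].
  exact: (connected_setU e_sym conC conD Ca Db ab).
have {}far a b : a \in C -> b \in D -> (a != b) && ~~ e a b.
  by move=> Ca Db; have /exists_inPn/(_ b Db) := far a Ca; rewrite negb_or.
have CD : [disjoint C & D].
  rewrite -setI_eq0; apply/eqP/setP => z; rewrite !inE; apply/negP => /andP[Cz Dz].
  by have := far z z Cz Dz; rewrite eqxx.
have neCD : C != D.
  by apply: contraTneq CD => ->; rewrite -setI_eq0 setIid (tconnected_neq0 tD).
have inside E F : tconnected e t E -> tconnected e t F -> E :&: F != set0 ->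
    (forall a b, a \in E :&: F -> b \in E :\: F -> ~~ e a b) -> E = F.
  move=> /andP[/eqP cE /(connected_cutP e_sym) cutE] /andP[/eqP cF _] EF0 noedge.
  apply/eqP; rewrite eqEcard cE cF leqnn andbT -setD_eq0; apply: contraT => DEF0.
  have [|a EFa [b]] := cutE (E :&: F) (subsetIl _ _) EF0.
    by rewrite setDIr setDv set0U.
  by rewrite setDIr setDv set0U => /(noedge _ _ EFa)/negP.
have indCD : induced_matching (tconnected_hypergraph e t) [set C; D].
  apply/andP; split.
    apply/andP; split; first by rewrite subUset !sub1set !inE tC tD.
    apply/trivIsetP => A B; rewrite !inE => /orP[]/eqP-> /orP[]/eqP->;
      by rewrite ?eqxx // disjoint_sym.
  apply/forall_inP => E; rewrite inE => tE; apply/implyP.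
  rewrite /cover bigcup_setU !big_set1 => sE; rewrite !inE.
  have [z Ez] := set0Pn _ (tconnected_neq0 tE).
  have sE' b : b \in E -> (b \in C) || (b \in D) by move=> /(subsetP sE); rewrite inE.
  have /orP[Cz|Dz] := sE' z Ez; apply/orP; [left|right]; apply/eqP; apply: inside => //.
  - by apply/set0Pn; exists z; rewrite inE Ez.
  - move=> a b; rewrite !inE => /andP[_ Ca] /andP[/negbTE nCb /sE'].
    by rewrite nCb => /(far a b Ca)/andP[].
  - by apply/set0Pn; exists z; rewrite inE Ez.
  - move=> a b; rewrite !inE => /andP[_ Da] /andP[/negbTE nDb /sE'].
    by rewrite nDb orbF e_sym => Cb; have /andP[] := far b a Cb Da.
move: gf; rewrite /tgap_free leqNgt => /negP[].
have -> : 1 < induced_matching_number (tconnected_hypergraph e t).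
  by apply: leq_trans (leq_bigmax_cond _ indCD); rewrite cards2 neCD.
by [].
Qed.

End GapFree.

(** * Monomial ideals *)

Section MonomialIdeals.
Import mpoly.
Import GRing.Theory.
Local Open Scope ring_scope.
Variables (K : fieldType) (n : nat).
Local Notation S := {mpoly K[n]}.
Implicit Types (p q : S) (gens : S -> Prop) (u v : seq 'X_{1..n}).

Lemma lepm_mdeg_eq (m m' : 'X_{1..n}) : (m <= m')%MM -> mdeg m = mdeg m' -> m = m'.
Proof.
move=> /submK le; rewrite -{1}le mdegD => /eqP.
rewrite -{1}[mdeg m]add0n eqn_add2r eq_sym mdeg_eq0.
by move=> /eqP d0; rewrite -le d0 add0m.
Qed.

(** Once the term of [q] at [m2] is removed, no monomial of [q] divides [m1 + m2]. *)
Lemma mcoeffM_unique p q m1 m2 :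
  (forall m, m \in msupp q -> (m <= m1 + m2)%MM -> m = m2) ->
  (p * q)@_(m1 + m2) = p@_m1 * q@_m2.
Proof.
move=> + ; rewrite addmC => uniq_m2; rewrite -{1}[q](subrK (q@_m2 *: 'X_[m2])) mulrDr mcoeffD.
rewrite -scalerAr mcoeffZ mcoeffMX [q@_m2 * _]mulrC -[RHS]add0r; congr (_ + _).
apply: memN_msupp_eq0.
apply/negP => /msuppM_le/allpairsP[[a b] /= [_]].
rewrite (perm_mem (msupp_rem _ _)) mem_rem_uniq ?msupp_uniq // inE => /andP[bm2 bq] eqm.
by case/eqP: bm2; apply: uniq_m2 bq _; rewrite eqm lem_addl.
Qed.

Lemma ideal_gen_mem gens p : gens p -> ideal_gen gens p.
Proof.
exists [:: (1, p)] => [c|]; first by rewrite inE => /eqP->.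
by rewrite big_seq1 mul1r.
Qed.

Lemma ideal_gen0 gens : ideal_gen gens 0.
Proof. by exists [::] => //; rewrite big_nil. Qed.

Lemma ideal_genD gens p q :
  ideal_gen gens p -> ideal_gen gens q -> ideal_gen gens (p + q).
Proof.
move=> [s sP ->] [r rP ->]; exists (s ++ r) => [c|]; last by rewrite big_cat.
by rewrite mem_cat => /orP[/sP|/rP].
Qed.

Lemma ideal_genM gens p q : ideal_gen gens q -> ideal_gen gens (p * q).
Proof.
move=> [s sP ->]; exists [seq (p * c.1, c.2) | c <- s] => [_ /mapP[c /sP cP ->] //|].
by rewrite big_map mulr_sumr; apply: eq_bigr => c _; rewrite mulrA.
Qed.

Lemma ideal_gen_sum gens (I : eqType) (r : seq I) (F : I -> S) :
  (forall i, i \in r -> ideal_gen gens (F i)) -> ideal_gen gens (\sum_(i <- r) F i).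
Proof.
move=> FP; rewrite big_seq; apply: (big_ind (ideal_gen gens)) => //.
  exact: ideal_gen0.
exact: ideal_genD.
Qed.

Lemma ideal_gen_trans gens gens' p :
  (forall q, gens q -> ideal_gen gens' q) -> ideal_gen gens p -> ideal_gen gens' p.
Proof.
move=> sub [s sP ->]; apply: ideal_gen_sum => c /sP/sub; exact: ideal_genM.
Qed.

(** [P] is a predicate rather than a list, to cover both [monomial_ideal] and the ideal of
    t-connected sets. *)
Lemma ideal_gen_monomialP (P : 'X_{1..n} -> Prop) p :
  ideal_gen (fun q => exists2 m, P m & q = 'X_[m]) p <->
  forall m, m \in msupp p -> exists2 m0, P m0 & (m0 <= m)%MM.
Proof.
split=> [[s sP ->] m /msupp_sum_le /flatten_mapP[c]|supP].
  rewrite mem_filter => /andP[_ /sP[m0 Pm0 ->]] /msuppM_le/allpairsP[[m1 m2] /= [_]].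
  by rewrite msuppX inE => /eqP-> ->; exists m0 => //; apply: lem_addl.
rewrite [p]mpolyE; apply: ideal_gen_sum => m /supP[m0 Pm0 le_m].
rewrite -mul_mpolyC -(submK le_m) mpolyXD mulrA; apply: ideal_genM.
by apply: ideal_gen_mem; exists m0.
Qed.

Lemma monomial_idealP u p :
  monomial_ideal u p <-> forall m, m \in msupp p -> exists2 m0, m0 \in u & (m0 <= m)%MM.
Proof. exact: ideal_gen_monomialP. Qed.

Lemma monomial_ideal_X u m :
  monomial_ideal u ('X_[m] : S) <-> exists2 m0, m0 \in u & (m0 <= m)%MM.
Proof.
rewrite monomial_idealP; split=> [|le m']; first by apply; rewrite msuppX inE.
by rewrite msuppX inE => /eqP->.
Qed.

Lemma variables_idealP (A : {set 'I_n}) p :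
  variables_ideal A p <-> forall m, m \in msupp p -> exists2 k, k \in A & (0 < m k)%N.
Proof.
split=> [[s sP ->] m /msupp_sum_le /flatten_mapP[c]|supP].
  rewrite mem_filter => /andP[_ /sP[k Ak ->]] /msuppM_le/allpairsP[[m1 m2] /= [_]].
  rewrite msuppX inE => /eqP-> ->; exists k => //.
  by rewrite mnmDE mnm1E eqxx addn1.
rewrite [p]mpolyE; apply: ideal_gen_sum => m /supP[k Ak mk].
have le_m : (U_(k) <= m)%MM by rewrite lep1mP -lt0n.
rewrite -mul_mpolyC -(submK le_m) mpolyXD mulrA; apply: ideal_genM.
by apply: ideal_gen_mem; exists k.
Qed.

Lemma variables_ideal_sum (A : {set 'I_n}) p :
  variables_ideal A p <-> exists c : 'I_n -> S, p = \sum_(k in A) c k * 'X_k.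
Proof.
split=> [[s sP ->]|[c ->]]; last first.
  rewrite -big_filter; apply: ideal_gen_sum => k.
  rewrite mem_filter => /andP[Ak _]; apply: ideal_genM; apply: ideal_gen_mem.
  by exists k.
elim: s sP => [|[a b] s IH] sP.
  by exists (fun=> 0); rewrite big_nil big1 // => k _; rewrite mul0r.
have [c cP] := IH (fun c cs => sP c (mem_behead (s := (a, b) :: s) cs)).
have [/= k Ak ->] := sP (a, b) (mem_head _ _).
exists (fun i => (if i == k then a else 0) + c i); rewrite big_cons cP /=.
under [RHS]eq_bigr do rewrite mulrDl.
rewrite big_split /=; congr (_ + _).
by rewrite (bigD1 k) //= eqxx big1 ?addr0 // => i /andP[_ /negbTE->]; rewrite mul0r.
Qed.

Lemma monomial_colonP u m p :
  colon (monomial_ideal u) (monomial_ideal [:: m]) p <-> monomial_ideal u (p * 'X_[m]).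
Proof.
split=> [colp|Ipm q].
  by apply: colp; apply: ideal_gen_mem; exists m; rewrite ?inE.
case=> s sP ->; rewrite mulr_sumr; apply: ideal_gen_sum => c /sP[m'].
by rewrite inE => /eqP-> ->; rewrite mulrCA; apply: ideal_genM.
Qed.

(* The monomial form of the condition that all colon ideals are generated by
   variables. *)
Definition linear_quotient_seq u : Prop :=
  forall i j, (i < j < size u)%N -> exists l k,
    [/\ (l < j)%N, (nth 0%MM u l <= U_(k) + nth 0%MM u j)%MM
      & (nth 0%MM u j k < nth 0%MM u i k)%N].

Lemma linear_quotient_seq_colon u j : linear_quotient_seq u -> (j < size u)%N ->
  exists A : {set 'I_n},
    same_ideal (colon (monomial_ideal (take j u) : S -> Prop) (monomial_ideal [:: nth 0%MM u j]))
               (variables_ideal A).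
Proof.
(* The set collects the variables that carry generator [j] into a multiple of an earlier
   generator. *)
move=> lqu ltj; exists [set k | has (fun m => (m <= U_(k) + nth 0%MM u j)%MM) (take j u)].
move=> p; rewrite monomial_colonP monomial_idealP variables_idealP.
split=> [supp m mp|supp m].
  have [|m0] := supp (nth 0%MM u j + m)%MM.
    by rewrite (perm_mem (msuppMX _ _)) map_f.
  move/(nthP 0%MM) => [i]; rewrite size_takel ?(ltnW ltj) // => lti.
  rewrite nth_take // => <- le_m; have [|l [k [ltl le_l lt_k]]] := lqu i j.
    by rewrite lti.
  exists k; last first.
    move/mnm_lepP/(_ k): le_m; rewrite mnmDE.
    by move: lt_k => /leq_trans/[apply]; rewrite -addn1 leq_add2l.
  rewrite inE; apply/hasP; exists (nth 0%MM u l) => //.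
  by rewrite -(nth_take 0%MM ltl) mem_nth // size_takel // ltnW.
rewrite (perm_mem (msuppMX _ _)) => /mapP[m' /supp[k + mk] ->].
rewrite inE => /hasP[m0 m0u le_m0]; exists m0 => //; apply: lepm_trans le_m0 _.
apply/mnm_lepP => i; rewrite !mnmDE addnC leq_add2l.
by move: i; apply/mnm_lepP; rewrite lep1mP -lt0n.
Qed.

End MonomialIdeals.

(** * Linear resolutions from linear quotients *)

Section LinearQuotients.
Import mpoly.
Import GRing.Theory.
Local Open Scope ring_scope.
Variables (K : fieldType) (n : nat).
Local Notation S := {mpoly K[n]}.

(** This allows a syzygy of a homogeneous matrix to be cut down to a graded component. *)
Lemma pihomog_mulr_homog e d (p q : S) : q \is d.-homog ->
  pihomog mdeg e p * q = pihomog mdeg (e + d) (p * q).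
Proof.
move=> qd; rewrite [p]mpolyE linear_sum !mulr_suml linear_sum /=.
apply: eq_bigr => m _; rewrite linearZ /= pihomogX.
have cXq : p@_m *: 'X_[m] * q \is (mdeg m + d).-homog.
  by apply: dhomogM => //; rewrite dhomogZ // dhomogX.
have [me|me] := eqVneq (mdeg m) e; first by rewrite pihomog_dE // -me.
by rewrite scaler0 mul0r (pihomog_ne0 _ cXq) // eqn_add2r.
Qed.

Definition homog_mx m r d (B : 'M[S]_(m, r)) : Prop := forall i j, B i j \is d.-homog.

(* The rows of [B], ordered by [h], have linear quotients: [p] times row [j] lies
   in the span of the rows before [j] iff [p] lies in the ideal of the variables
   indexed by [A j]. *)
Definition linear_quotient_mx m r (B : 'M[S]_(m, r)) (h : 'I_m -> nat)
    (A : 'I_m -> {set 'I_n}) : Prop :=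
  injective h /\ forall j p,
    (exists v : 'rV_m, [/\ v *m B = 0, v 0 j = p &
       forall l, (h j < h l)%N -> v 0 l = 0]) <-> variables_ideal (A j) p.

Lemma variables_ideal_mulX (A : {set 'I_n}) k (p : S) :
  k \notin A -> variables_ideal A (p * 'X_k) -> variables_ideal A p.
Proof.
move=> nAk; rewrite !variables_idealP => supp m mp.
have [|i Ai] := supp (U_(k) + m)%MM; first by rewrite (perm_mem (msuppMX _ _)) map_f.
rewrite mnmDE mnm1E; have [ki|_] := eqVneq k i; first by rewrite ki Ai in nAk.
by rewrite add0n; exists i.
Qed.

Lemma variables_idealX (A : {set 'I_n}) k : k \in A -> variables_ideal A ('X_k : S).
Proof. by move=> Ak; apply: ideal_gen_mem; exists k. Qed.

(** * Syzygies of a matrix with linear quotients *)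

Section Syzygies.
Variables (m r : nat) (B : 'M[S]_(m, r)) (h : 'I_m -> nat) (A : 'I_m -> {set 'I_n}).
Variable d : nat.
Hypotheses (lqB : linear_quotient_mx B h A) (homB : homog_mx d B).

(** The colon condition at ['X_k] yields a syzygy; its degree 1 component is still one, because all
    entries of [B] have degree [d], and it retains the entry ['X_k]. *)
Lemma linear_syzygies : exists G : 'I_m -> 'I_n -> 'rV[S]_m, forall j k, k \in A j ->
  [/\ G j k *m B = 0, G j k 0 j = 'X_k, forall l, (h j < h l)%N -> G j k 0 l = 0
    & homog_mx 1 (G j k)].
Proof.
have [_ lq] := lqB.
suff /fin_all_exists[G GP] : forall x : 'I_m * 'I_n, exists g : 'rV[S]_m, x.2 \in A x.1 ->
    [/\ g *m B = 0, g 0 x.1 = 'X_x.2, forall l, (h x.1 < h l)%N -> g 0 l = 0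
      & homog_mx 1 g].
  by exists (fun j k => G (j, k)) => j k; apply: (GP (j, k)).
move=> [j k] /=; have [Ak|_] := boolP (k \in A j); last by exists 0.
have [v [vB vj v0]] := (lq j _).2 (variables_idealX Ak).
exists (map_mx (pihomog mdeg 1) v) => _; split=> [||l /v0|i l].
- apply/rowP => c; rewrite !mxE; have /rowP/(_ c) := vB; rewrite !mxE => vBc.
  under eq_bigr => l _ do rewrite mxE (pihomog_mulr_homog _ _ (homB l c)).
  by rewrite -linear_sum /= vBc linear0.
- by rewrite mxE vj pihomog_dE // dhomogX /= mdeg1.
- by rewrite mxE => ->; rewrite linear0.
by rewrite mxE pihomogP.
Qed.

Variable G : 'I_m -> 'I_n -> 'rV[S]_m.
Hypothesis GP : forall j k, k \in A j ->
  [/\ G j k *m B = 0, G j k 0 j = 'X_k, forall l, (h j < h l)%N -> G j k 0 l = 0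
    & homog_mx 1 (G j k)].

(** A division algorithm: the last entry of [v] lies in the variable ideal of its row, so a
    combination of the [G j k] cancels it. The bound [N] on the rows used serves to prove linear
    quotients for the syzygies. *)
Lemma syzygy_span N (v : 'rV[S]_m) :
  v *m B = 0 -> (forall l, (N <= h l)%N -> v 0 l = 0) ->
  exists2 f : 'I_m -> 'I_n -> S, (forall j k, (N <= h j)%N -> f j k = 0) &
    v = \sum_j \sum_(k in A j) f j k *: G j k.
Proof.
have [injh lq] := lqB.
elim: N v => [|N IH] v vB v0.
  exists (fun _ _ => 0) => //; rewrite big1 => [|j _].
    by apply/rowP => l; rewrite mxE v0.
  by rewrite big1 // => k _; rewrite scale0r.
have [/existsP[j /eqP hj]|/existsPn nh] := boolP [exists j, h j == N]; last first.
  have [|f f0 vE] := IH v vB.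
    by move=> l; rewrite leq_eqVlt eq_sym (negbTE (nh l)); apply: v0.
  by exists f => // j k /ltnW; apply: f0.
have /variables_ideal_sum[c vj] : variables_ideal (A j) (v 0 j).
  by apply/(lq j); exists v; split=> // l; rewrite hj; apply: v0.
have [||f f0 vE] := IH (v - \sum_(k in A j) c k *: G j k).
- rewrite mulmxBl vB sub0r mulmx_suml big1 ?oppr0 // => k /GP[GB _ _ _].
  by rewrite -scalemxAl GB scaler0.
- move=> l; rewrite leq_eqVlt => /orP[/eqP Nl|ltNl]; rewrite mxE mxE summxE.
    have -> : l = j by apply: injh; rewrite hj Nl.
    rewrite vj -sumrB big1 // => k /GP[_ Gj _ _].
    by rewrite mxE Gj subrr.
  rewrite v0 // big1 ?subr0 // => k /GP[_ _ G0 _].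
  by rewrite mxE G0 ?mulr0 // hj.
exists (fun i k => f i k + (if i == j then c k else 0)) => [i k lt|].
  rewrite f0 ?(ltnW lt) // add0r; case: eqP => // ij.
  by rewrite ij hj ltnn in lt.
rewrite -[LHS](subrK (\sum_(k in A j) c k *: G j k)) vE.
under [RHS]eq_bigr => i _ do under eq_bigr => k _ do rewrite scalerDl.
under [RHS]eq_bigr => i _ do rewrite big_split /=.
rewrite big_split /=; congr (_ + _).
rewrite [RHS](bigD1 j) //= eqxx [X in _ = _ + X]big1 ?addr0 // => i /negbTE->.
by rewrite big1 // => k _; rewrite scale0r.
Qed.

Let E := [set x : 'I_m * 'I_n | x.2 \in A x.1].

Definition syzygy_mx : 'M[S]_(#|E|, m) :=
  \matrix_i G (enum_val i).1 (enum_val i).2.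

(** The lexicographic order on pairs [(j, k)], encoded in one number since [k < n]. *)
Definition syzygy_rank (i : 'I_#|E|) : nat :=
  (h (enum_val i).1 * n + (enum_val i).2)%N.

Definition syzygy_variables (i : 'I_#|E|) : {set 'I_n} :=
  [set k in A (enum_val i).1 | (k < (enum_val i).2)%N].

Lemma mul_syzygy_mx (f : 'I_m -> 'I_n -> S) :
  (\row_i f (enum_val i).1 (enum_val i).2) *m syzygy_mx =
  \sum_j \sum_(k in A j) f j k *: G j k.
Proof.
rewrite pair_big_dep /= mulmx_sum_row.
rewrite [RHS](eq_bigl (fun x => x \in E)) /=; last by move=> x; rewrite inE.
by rewrite [RHS]big_enum_val; apply: eq_bigr => i _; rewrite rowK mxE.
Qed.

Lemma syzygyP (v : 'rV[S]_m) : v *m B = 0 <-> exists w, v = w *m syzygy_mx.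
Proof.
split=> [vB|[w ->]]; last first.
  rewrite -mulmxA; suff -> : syzygy_mx *m B = 0 by rewrite mulmx0.
  apply/row_matrixP => i; rewrite row_mul rowK row0.
  by have := enum_valP i; rewrite inE => /GP[].
have [|f _ vE] := @syzygy_span (\max_j h j).+1 v vB.
  by move=> l; rewrite ltnNge leq_bigmax.
by exists (\row_i f (enum_val i).1 (enum_val i).2); rewrite mul_syzygy_mx.
Qed.

Lemma syzygy_mx_homog : homog_mx 1 syzygy_mx.
Proof.
move=> i j; rewrite mxE; have := enum_valP i; rewrite inE => /GP[_ _ _]; exact.
Qed.

Lemma syzygy_rank_lt (i i' : 'I_#|E|) : h (enum_val i).1 = h (enum_val i').1 /\
  ((enum_val i).2 < (enum_val i').2)%N \/ (h (enum_val i).1 < h (enum_val i').1)%N ->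
  (syzygy_rank i < syzygy_rank i')%N.
Proof.
rewrite /syzygy_rank => -[[-> lt]|lt]; first by rewrite ltn_add2l.
have := ltn_ord (enum_val i).2; have := leq_mul lt (leqnn n); rewrite mulSn; lia.
Qed.

(** Column [j] of a relation ending at [(j, k)] reads [p * 'X_k] plus multiples of ['X_k'] with
    [k' < k], as the rows of earlier [j'] vanish there. Conversely, for [p] in that variable ideal,
    [p *: G j k] minus suitable multiples of the [G j b], [b < k], has entry 0 at [j] and can be
    rewritten by earlier rows. *)
Lemma syzygy_mx_linear_quotients :
  linear_quotient_mx syzygy_mx syzygy_rank syzygy_variables.
Proof.
have [injh lq] := lqB.
have ind_inj (i i' : 'I_#|E|) :
    h (enum_val i).1 = h (enum_val i').1 -> (enum_val i).2 = (enum_val i').2 -> i = i'.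
  move=> /injh eq1 eq2; apply: enum_val_inj.
  by rewrite (surjective_pairing (enum_val i)) eq1 eq2 -surjective_pairing.
split=> [i i' eqr|i p].
  have nlt P : False := elimF idP (leq_gtF (eq_leq (esym eqr))) (@syzygy_rank_lt i i' P).
  have nlt' P : False := elimF idP (leq_gtF (eq_leq eqr)) (@syzygy_rank_lt i' i P).
  have [lt|lt|eqh] := ltngtP (h (enum_val i).1) (h (enum_val i').1).
  - by case: nlt; right.
  - by case: nlt'; right.
  have [lt|lt|/val_inj eqk] := ltngtP (enum_val i).2 (enum_val i').2.
  - by case: nlt; left.
  - by case: nlt'; left.
  exact: ind_inj.
have := enum_valP i; rewrite inE.
set j := (enum_val i).1; set k := (enum_val i).2 => Ak.
have [GB Gj G0 _] := GP Ak.
split=> [[w [wB wi w0]]|/variables_ideal_sum[c pE]].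
  (* ['X_k] can be cancelled, since [k] is not among the smaller indices. *)
  apply: (@variables_ideal_mulX _ k); first by rewrite inE ltnn andbF.
  have /rowP/(_ j) := wB; rewrite !mxE (bigD1 i) //= wi [syzygy_mx i j]mxE Gj.
  move/eqP; rewrite addr_eq0 => /eqP->; rewrite -sumrN -big_filter.
  apply: ideal_gen_sum => i'; rewrite mem_filter => /andP[ne _].
  rewrite -mulNr mxE; have := enum_valP i'; rewrite inE.
  have := @syzygy_rank_lt i i'; have := @ind_inj i' i; rewrite -/j -/k.
  set j' := (enum_val i').1; set k' := (enum_val i').2 => ind_eq rank_lt Ak'.
  have [_ Gj' G0' _] := GP Ak'.
  have [lt|gt|eqh] := ltngtP (h j') (h j).
  - by rewrite G0' // mulr0; apply: ideal_gen0.
  - by rewrite w0 ?oppr0 ?mul0r; [apply: ideal_gen0|apply: rank_lt; right].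
  have jj := injh _ _ eqh; have [lt|gt|/val_inj eqk] := ltngtP k' k.
  - rewrite -jj Gj'; apply: ideal_genM; apply: variables_idealX.
    by rewrite inE lt -/j -jj Ak'.
  - rewrite w0 ?oppr0 ?mul0r; first exact: ideal_gen0.
    by apply: rank_lt; left.
  by rewrite ind_eq ?eqxx in ne.
pose f a b := (if (a == j) && (b == k) then p else 0)
  - (if (a == j) && (b < k)%N then c b * 'X_k else 0).
have fE : \sum_a \sum_(b in A a) f a b *: G a b =
    p *: G j k - \sum_(b in syzygy_variables i) (c b * 'X_k) *: G j b.
  under eq_bigr => a _ do under eq_bigr => b _ do rewrite scalerBl.
  under eq_bigr => a _ do rewrite sumrB.
  rewrite sumrB; congr (_ - _).
    rewrite (bigD1 j) //= [X in _ + X]big1 ?addr0 => [|a /negbTE->]; last first.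
      by rewrite big1 // => b _; rewrite scale0r.
    rewrite (bigD1 k) //= !eqxx big1 ?addr0 // => b /andP[_ /negbTE->].
    by rewrite andbF scale0r.
  rewrite (bigD1 j) //= [X in _ + X]big1 ?addr0 => [|a /negbTE->]; last first.
    by rewrite big1 // => b _; rewrite scale0r.
  rewrite [RHS](eq_bigl (fun b => (b \in A j) && (b < k)%N)) => [|b]; last by rewrite inE.
  rewrite big_mkcondr; apply: eq_bigr => b _; rewrite eqxx /=.
  by case: ifP => // _; rewrite scale0r.
have varA b : b \in syzygy_variables i -> b \in A j by rewrite inE => /andP[].
have zB : (\sum_a \sum_(b in A a) f a b *: G a b) *m B = 0.
  rewrite mulmx_suml big1 // => a _; rewrite mulmx_suml big1 // => b /GP[GB' _ _ _].
  by rewrite -scalemxAl GB' scaler0.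
(* The bound [h j] restricts [f'] to pairs whose first component is strictly before [j]. *)
have [|f' f'0 zE] := @syzygy_span (h j) _ zB.
  rewrite fE => l; rewrite leq_eqVlt => /orP[/eqP/injh <-|ltl]; rewrite mxE mxE mxE summxE.
    rewrite Gj {1}pE mulr_suml -sumrB big1 // => b /varA/GP[_ Gb _ _].
    by rewrite mxE Gb mulrAC subrr.
  rewrite G0 // mulr0 big1 ?subr0 // => b /varA/GP[_ _ Gb _].
  by rewrite mxE Gb // mulr0.
(* The two expressions of the same vector differ by a relation with coefficient [p] at [(j, k)]. *)
exists (\row_i' (f (enum_val i').1 (enum_val i').2 - f' (enum_val i').1 (enum_val i').2)).
split=> [||i' lt].
- rewrite (mul_syzygy_mx (fun a b => f a b - f' a b)).
  under eq_bigr => a _ do under eq_bigr => b _ do rewrite scalerBl.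
  under eq_bigr => a _ do rewrite sumrB.
  by rewrite sumrB -zE subrr.
- by rewrite mxE /f !eqxx ltnn subr0 f'0 // subr0.
have nlt P : False := elimF idP (leq_gtF (ltnW lt)) (@syzygy_rank_lt i' i P).
have le : (h j <= h (enum_val i').1)%N.
  by rewrite leqNgt; apply/negP => lt'; apply: nlt; right.
rewrite mxE f'0 //.
rewrite subr0 /f; case: eqP => [eqj|_]; last by rewrite subrr.
rewrite /=; case: eqP => [eqk|_].
  by rewrite (@ind_inj i' i) ?ltnn ?eqj // in lt.
case: ifP => [ltk|_]; last by rewrite subrr.
by case: nlt; left; split; rewrite ?eqj.
Qed.

End Syzygies.

End LinearQuotients.

(** * Iterating syzygies to a linear resolution *)

Section LinearResolution.
Import mpoly.
Import GRing.Theory.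
Local Open Scope ring_scope.
Variables (K : fieldType) (n : nat).
Local Notation S := {mpoly K[n]}.

(** The order, the variable sets and the degree are hidden in existentials, so that each step of the
    iteration returns an object of the same type. *)
Record graded_lq_matrix := GradedLQMatrix {
  lq_rows : nat;
  lq_cols : nat;
  lq_mx :> 'M[S]_(lq_rows, lq_cols);
  lq_mxP : exists h A, linear_quotient_mx lq_mx h A;
  lq_homog : exists d, homog_mx d lq_mx
}.

Definition is_linear_syzygy_mx (B : graded_lq_matrix)
    (C : {m : nat & 'M[S]_(m, lq_rows B)}) : Prop :=
  [/\ exists h A, linear_quotient_mx (projT2 C) h A, homog_mx 1 (projT2 C) &
      forall v : 'rV_(lq_rows B), v *m B = 0 <-> exists w, v = w *m projT2 C].

Lemma ex_linear_syzygy_mx (B : graded_lq_matrix) : exists C, @is_linear_syzygy_mx B C.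
Proof.
have [h [A lqB]] := lq_mxP B; have [d homB] := lq_homog B.
have [G GP] := linear_syzygies lqB homB.
exists (existT (fun m => 'M[S]_(m, lq_rows B)) _ (syzygy_mx A G)); split=> /=.
- do 2 eexists; exact: (syzygy_mx_linear_quotients lqB GP).
- exact: (syzygy_mx_homog GP).
exact: (syzygyP lqB GP).
Qed.

(** Choice turns the existence of a syzygy matrix into a function that can be iterated. *)
Definition syzygies (B : graded_lq_matrix) :=
  constructive_indefinite_description _ (ex_linear_syzygy_mx B).

(* [lq_cols (next_lq_matrix B)] is convertible to [lq_rows B], so that the
   matrices of the iterates compose without casts. *)
Definition next_lq_matrix (B : graded_lq_matrix) : graded_lq_matrix :=
  let P := proj2_sig (syzygies B) in
  @GradedLQMatrix _ _ (projT2 (proj1_sig (syzygies B)))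
    (let: And3 lqC _ _ := P in lqC) (let: And3 _ homC _ := P in ex_intro _ 1%N homC).

Lemma homog1_variables_ideal (p : S) :
  p \is 1.-homog -> variables_ideal [set: 'I_n] p.
Proof.
move=> /dhomogP hom1; apply/variables_idealP => m /hom1 /= /eqP.
by rewrite mdeg_eq1 => /existsP[k /eqP->]; exists k; rewrite ?inE // mnm1E eqxx.
Qed.

(** Each matrix spans the kernel of the preceding one, which gives exactness; its linear entries lie
    in the ideal of all variables, which gives minimality. *)
Lemma linear_quotient_mx_resolution m t (u : 'cV[S]_m) h A (I : S -> Prop) :
  linear_quotient_mx u h A -> homog_mx t u ->
  (forall p, I p <-> exists v : 'rV_m, p = (v *m u) 0 0) ->
  has_linear_resolution t I.
Proof.
move=> lqu homu Iu.
pose B0 := GradedLQMatrix (ex_intro _ h (ex_intro _ A lqu)) (ex_intro _ t homu).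
pose B i := iter i next_lq_matrix B0.
pose d i : 'M[S]_(lq_rows (B i.+1), lq_rows (B i)) := lq_mx (B i.+1).
(* Generators have degree [t] and each differential has linear entries, whence the shift [i + t]. *)
pose F := @FreeSequence K n (fun i => lq_rows (B i)) (fun i _ => i + t)%N d u.
have hom_d i : homog_mx 1 (d i) by case: (proj2_sig (syzygies (B i))).
have ker_d i (v : 'rV[S]_(lq_rows (B i))) :
    v *m lq_mx (B i) = 0 <-> exists w, v = w *m d i.
  by case: (proj2_sig (syzygies (B i))).
exists (fun i j => #|[set a : 'I_(rk F i) | shift a == j]|); last first.
  move=> i j /eqP ij; apply/eqP; rewrite cards_eq0; apply/eqP/setP => a.
  by rewrite !inE eq_sym (negbTE ij).
exists F => //; split.
- split=> [a|i a b _|i a b /=]; first exact: homu.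
    by rewrite /= addSn subSn // subnn; apply: hom_d.
  by rewrite addSn ltnNge ltnW.
- by split=> [||i]; [exact: Iu | exact: (ker_d 0%N) | exact: (ker_d i.+1)].
by move=> i a b; apply: homog1_variables_ideal; apply: hom_d.
Qed.

(** Coefficients are merged into one per position, indexed by [nat] so that [j] can vary in the
    induction. *)
Lemma monomial_ideal_takeP (u : seq 'X_{1..n}) j (p : S) : (j <= size u)%N ->
  monomial_ideal (take j u) p <->
  exists c : nat -> S, p = \sum_(0 <= i < j) c i * 'X_[nth 0%MM u i].
Proof.
elim: j p => [|j IH] p ltj.
  rewrite take0; split=> [[s sP ->]|[c ->]].
    by exists (fun=> 0); rewrite !big_nil big_seq big1 // => c /sP[].
  by rewrite big_nil; apply: ideal_gen0.
rewrite (take_nth 0%MM) //; split=> [[s sP ->]|[c ->]].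
  elim: s sP => [|[a b] s IHs] sP.
    by exists (fun=> 0); rewrite big_nil big1 // => i _; rewrite mul0r.
  have [c cE] := IHs (fun x xs => sP x (mem_behead (s := (a, b) :: s) xs)).
  have [/= m + bE] := sP (a, b) (mem_head _ _); rewrite mem_rcons inE => /orP mP.
  have [c' c'E] : exists c' : nat -> S,
      a * b = \sum_(0 <= i < j.+1) c' i * 'X_[nth 0%MM u i].
    case: mP => [/eqP mE|mu].
      exists (fun i => if i == j then a else 0); rewrite big_nat_recr //= eqxx -mE -bE.
      rewrite big_nat big1 ?add0r // => i /andP[_ lti].
      by rewrite (ltn_eqF lti) mul0r.
    have /(IH _ (ltnW ltj))[c' c'E] : monomial_ideal (take j u) (a * b).
      by apply: ideal_genM; apply: ideal_gen_mem; exists m.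
    exists (fun i => if i == j then 0 else c' i); rewrite big_nat_recr //= eqxx mul0r addr0 c'E.
    by apply: eq_big_nat => i /andP[_ lti]; rewrite (ltn_eqF lti).
  exists (fun i => c' i + c i); rewrite big_cons cE c'E -big_split /=.
  by apply: eq_bigr => i _; rewrite mulrDl.
have sub q : monomial_ideal (take j u) q ->
    monomial_ideal (rcons (take j u) (nth 0%MM u j)) q.
  apply: ideal_gen_trans => _ [m mu ->]; apply: ideal_gen_mem.
  by exists m; rewrite // mem_rcons inE mu orbT.
rewrite big_nat_recr //=; apply: ideal_genD.
  by apply: sub; apply/(IH _ (ltnW ltj)); exists c.
by apply: ideal_genM; apply: ideal_gen_mem; exists (nth 0%MM u j); rewrite // mem_rcons mem_head.
Qed.

(** The column of monomials has linear quotients in list order: a syzygy ending at row [j] with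
    entry [p] says that [p] times generator [j] lies in the ideal of the earlier ones. *)
Lemma monomial_linear_quotients_resolution t (u : seq 'X_{1..n}) (I : S -> Prop) :
  same_ideal I (monomial_ideal u) -> (forall m, m \in u -> mdeg m = t) ->
  (forall i, (0 < i < size u)%N -> exists A : {set 'I_n},
    same_ideal (colon (monomial_ideal (take i u)) (monomial_ideal [:: nth 0%MM u i]))
               (variables_ideal A : S -> Prop)) ->
  has_linear_resolution t I.
Proof.
move=> Iu degu lqu; set N := size u in lqu.
pose X : 'cV[S]_N := \col_i 'X_[nth 0%MM u i].
have [A AP] : exists A : 'I_N -> {set 'I_n}, forall (i : 'I_N) p,
    monomial_ideal (take i u) (p * 'X_[nth 0%MM u i] : S) <-> variables_ideal (A i) p.
  suff /fin_all_exists[A AP] : forall i : 'I_N, exists A : {set 'I_n}, forall p,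
      monomial_ideal (take i u) (p * 'X_[nth 0%MM u i] : S) <-> variables_ideal A p.
    by exists A.
  (* The hypothesis starts at the second generator; for the first, the colon ideal is zero and
     [set0] serves. *)
  move=> [i lti] /=; have [->|i0] := posnP i.
    exists set0 => p; rewrite take0 monomial_idealP variables_idealP.
    split=> supp m mp; last first.
      move: mp; rewrite (perm_mem (msuppMX _ _)) => /mapP[m' /supp[k]].
      by rewrite inE.
    have [|//] := supp (nth 0%MM u 0 + m)%MM.
    by rewrite (perm_mem (msuppMX _ _)) map_f.
  have [|A AP] := lqu i; first by rewrite i0 lti.
  by exists A => p; rewrite -AP monomial_colonP.
apply: (@linear_quotient_mx_resolution N t X val A).
- split=> [|j p]; first exact: val_inj.
  rewrite -AP monomial_ideal_takeP ?(ltnW (ltn_ord j)) //.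
  have mulX (V : nat -> S) : (forall l : 'I_N, (j < l)%N -> V l = 0) ->
      ((\row_i V i) *m X) 0 0 =
        \sum_(0 <= i < j) V i * 'X_[nth 0%MM u i] + V j * 'X_[nth 0%MM u j].
    move=> V0; rewrite mxE.
    under eq_bigr => i _ do rewrite !mxE.
    rewrite -(big_mkord xpredT (fun i => V i * 'X_[nth 0%MM u i])).
    rewrite (@big_cat_nat _ _ _ j.+1) //= big_nat_recr //= [X in _ + X]big_nat.
    rewrite [X in _ + X]big1 ?addr0 // => i /andP[ji iN].
    by rewrite (V0 (Ordinal iN)) // mul0r.
  split=> [[v [vX vj v0]]|[c cE]].
    pose V i := if insub i is Some l then v 0 l else 0.
    have VE (l : 'I_N) : V l = v 0 l by rewrite /V valK.
    have := mulX V; have -> : \row_i V i = v by apply/rowP => l; rewrite mxE VE.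
    rewrite vX mxE VE vj => /(_ _)/esym/eqP; rewrite addrC addr_eq0 => sumE.
    exists (fun i => - V i); have /eqP-> := sumE (fun l lt => etrans (VE l) (v0 l lt)).
    by rewrite -sumrN; apply: eq_bigr => i _; rewrite mulNr.
  pose V i := if (i < j)%N then - c i else if i == j then p else 0.
  exists (\row_i V i); split=> [||l jl].
  - apply/rowP => z; rewrite (ord1 z) mulX => [|l jl]; last first.
      by rewrite /V ltnNge ltnW // gtn_eqF.
    rewrite mxE /V ltnn eqxx cE -big_split /= big_nat big1 // => i /andP[_ ->].
    by rewrite mulNr addNr.
  - by rewrite mxE /V ltnn eqxx.
  by rewrite mxE /V ltnNge ltnW //= gtn_eqF.
- by move=> i j; rewrite mxE dhomogX; apply/eqP/degu/mem_nth.
move=> p; rewrite Iu -{1}(take_size u) monomial_ideal_takeP //.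
split=> [[c ->]|[v ->]].
  exists (\row_i c i); rewrite mxE big_mkord; apply: eq_bigr => i _.
  by rewrite !mxE.
exists (fun i => if insub i is Some j then v 0 j else 0).
by rewrite big_mkord mxE; apply: eq_bigr => i _; rewrite valK mxE.
Qed.

End LinearResolution.

(** * The t-connected ideal *)

Section TConnectedIdeal.
Variables (K : fieldType) (V : finType) (e : rel V) (t : nat).
Hypothesis e_sym : symmetric e.
Import mpoly.
Import GRing.Theory.
Local Open Scope ring_scope.
Local Notation S := {mpoly K[#|V|]}.
Implicit Types (C D E : {set V}).

Definition set_mnm C : 'X_{1..#|V|} := [multinom (enum_val i \in C : nat) | i < #|V|].

Lemma set_mnmE C v : set_mnm C (enum_rank v) = (v \in C).
Proof. by rewrite mnmE enum_rankK. Qed.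

Lemma vset_monomialE C : vset_monomial K C = 'X_[set_mnm C].
Proof.
rewrite mpolyXE_id (reindex enum_rank) /=; last by apply: onW_bij; apply: enum_rank_bij.
rewrite /vset_monomial big_mkcond; apply: eq_bigr => v _.
by rewrite set_mnmE; case: (v \in C).
Qed.

Lemma mdeg_set_mnm C : mdeg (set_mnm C) = #|C|.
Proof.
rewrite mdegE (reindex enum_rank) /=; last by apply: onW_bij; apply: enum_rank_bij.
rewrite -[RHS]sum1_card [RHS]big_mkcond; apply: eq_bigr => v _.
by rewrite set_mnmE; case: (v \in C).
Qed.

Lemma set_mnm_le C D : (set_mnm C <= set_mnm D)%MM = (C \subset D).
Proof.
apply/mnm_lepP/subsetP => [le v|sub i].
  by have := le (enum_rank v); rewrite !set_mnmE; case: (v \in C); case: (v \in D).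
by rewrite !mnmE; case: (boolP (_ \in C)) => // /sub ->.
Qed.

Lemma set_mnm_inj : injective set_mnm.
Proof. by move=> C D eqCD; apply/eqP; rewrite eqEsubset -!set_mnm_le eqCD !lepm_refl. Qed.

Lemma tconnected_idealP p : tconnected_ideal K e t p <->
  forall m, m \in msupp p -> exists2 C, tconnected e t C & (set_mnm C <= m)%MM.
Proof.
pose P (m : 'X_{1..#|V|}) := exists2 C, tconnected e t C & m = set_mnm C.
transitivity (ideal_gen (fun q : S => exists2 m, P m & q = 'X_[m]) p).
  split; apply: ideal_gen_trans => q.
    move=> [C tC ->]; rewrite vset_monomialE; apply: ideal_gen_mem.
    by exists (set_mnm C) => //; exists C.
  move=> [_ [C tC ->] ->]; apply: ideal_gen_mem.
  by exists C; rewrite // vset_monomialE.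
rewrite ideal_gen_monomialP; split=> supp m /supp.
  by move=> [_ [C tC ->] le]; exists C.
by move=> [C tC le]; exists (set_mnm C) => //; exists C.
Qed.

Lemma tconnected_ideal_X m : tconnected_ideal K e t ('X_[m]) <->
  exists2 C, tconnected e t C & (set_mnm C <= m)%MM.
Proof.
rewrite tconnected_idealP; split=> [|le m']; first by apply; rewrite msuppX inE.
by rewrite msuppX inE => /eqP->.
Qed.

(** A t-connected monomial divides [m] and is itself divisible by some [m'] in [u]; if [m'] differed
    from [m], then [m] would be redundant. *)
Lemma mingens_tconnected u m : is_mingens (tconnected_ideal K e t) u ->
  m \in u -> exists2 C, tconnected e t C & m = set_mnm C.
Proof.
move=> [uniq_u Iu minu] mu.
have [C tC leC] : exists2 C, tconnected e t C & (set_mnm C <= m)%MM.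
  by rewrite -tconnected_ideal_X; apply/Iu/monomial_ideal_X; exists m; rewrite ?lepm_refl.
have [m' m'u le'] : exists2 m', m' \in u & (m' <= set_mnm C)%MM.
  apply/(monomial_ideal_X K)/Iu/tconnected_ideal_X; exists C => //; exact: lepm_refl.
exists C => //; have [mm|mm] := eqVneq m' m.
  by apply/mnmP => i; apply/eqP; rewrite eqn_leq -{1}mm (mnm_lepP le') (mnm_lepP leC).
have : {subset u <= rem m u}.
  apply: minu => [x|p]; first exact: mem_rem.
  split=> [/Iu|Ip]; last first.
    apply/Iu; apply: ideal_gen_trans Ip => _ [x /mem_rem xu ->].
    by apply: ideal_gen_mem; exists x.
  apply: ideal_gen_trans => _ [x xu ->]; apply/monomial_ideal_X.
  have [->|xm] := eqVneq x m; last by exists x; rewrite ?lepm_refl // mem_rem_uniq // inE xm.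
  by exists m'; [rewrite mem_rem_uniq // inE mm|apply: lepm_trans leC].
by move/(_ m mu); rewrite mem_rem_uniq // inE eqxx.
Qed.

Lemma tconnected_linear_resolution :
  has_linear_quotients (tconnected_ideal K e t) ->
  has_linear_resolution t (tconnected_ideal K e t).
Proof.
move=> [u minu lqu]; have [_ Iu _] := minu.
apply: monomial_linear_quotients_resolution Iu _ lqu => m /(mingens_tconnected minu).
by move=> [C /andP[/eqP cardC _] ->]; rewrite mdeg_set_mnm.
Qed.

(* If [C] and [D] form an induced matching, then the coefficient of the
   monomial of [D] in the [C]-coordinate vanishes on all multiples of linear
   syzygies, but not on the syzygy between the monomials of [C] and [D]. *)
Lemma linear_resolution_tgap_free : (2 <= t)%N ->
  has_linear_resolution t (tconnected_ideal K e t) -> tgap_free e t.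
Proof.
move=> t2 [beta [F [[hom_aug hom_d _] [Iaug ker_aug _] _] betaF] lin].
apply: contraT => /negP/(not_tgap_free (ltnW t2))[C [D [tC tD disj ind]]].
(* Linearity of the Betti numbers fixes the degree of every basis element. *)
have shiftF i (a : 'I_(rk F i)) : shift a = (i + t)%N.
  apply/eqP; apply: contraT => /eqP/lin; rewrite betaF => /eqP.
  by rewrite cards_eq0 => /eqP/setP/(_ a); rewrite !inE eqxx.
have cardt E : tconnected e t E -> mdeg (set_mnm E) = t.
  by rewrite mdeg_set_mnm => /andP[/eqP].
have aug_supp a m : m \in msupp (aug F a 0) -> exists2 E, tconnected e t E & m = set_mnm E.
  move=> ma; have [E tE le] : exists2 E, tconnected e t E & (set_mnm E <= m)%MM.
    apply: ((tconnected_idealP (aug F a 0)).1 _ m ma); apply/Iaug.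
    by exists (delta_mx 0 a); rewrite -rowE mxE.
  exists E => //; apply/esym/lepm_mdeg_eq; rewrite // cardt //.
  by have /dhomogP/(_ m ma) := hom_aug a; rewrite shiftF.
have genF E : tconnected e t E -> exists v : 'rV_(rk F 0), 'X_[set_mnm E] = (v *m aug F) 0 0.
  by move=> tE; apply/Iaug/tconnected_ideal_X; exists E; rewrite ?lepm_refl.
have [vC vCE] := genF C tC; have [vD vDE] := genF D tD.
set mC := set_mnm C in vCE; set mD := set_mnm D in vDE.
(* The generators in [aug F] may be combinations of the monomials; [c] extracts their
   [C]-coordinates. *)
pose c a := (aug F a 0)@_mC.
pose L (v : 'rV[S]_(rk F 0)) := \sum_a (v 0 a)@_mD * c a.
pose v := 'X_[mD] *: vC - 'X_[mC] *: vD.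
have neCD : ~~ (mC <= mD)%MM.
  rewrite set_mnm_le; apply/negP => sCD; have := tconnected_neq0 (ltnW t2) tC.
  by rewrite -(setIidPl sCD) setI_eq0 disj.
have Lv : L v = 1.
  have -> : L v = \sum_a (vC 0 a)@_0 * c a.
    apply: eq_bigr => a _; congr (_ * _); rewrite !mxE mcoeffB.
    have := mcoeffMX (vC 0 a) mD 0; rewrite addm0 mulrC => ->.
    rewrite [X in _ - X](_ : _ = 0) ?subr0 //.
    apply/eqP; rewrite mcoeff_eq0 mulrC; apply: contra neCD.
    rewrite (perm_mem (msuppMX _ _)) => /mapP[m _ ->]; exact: lem_addr.
  have := congr1 (mcoeff mC) vCE; rewrite mcoeffX eqxx mxE linear_sum /= mulr1n => ->.
  apply: eq_bigr => a _; rewrite -[mC in RHS]add0m mcoeffM_unique // add0m => m ma le.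
  by apply: lepm_mdeg_eq le _; have [E tE ->] := aug_supp a m ma; rewrite !cardt.
have [w vE] : exists w, v = w *m bdry F 0.
  apply/ker_aug; apply/rowP => z; rewrite (ord1 z) mulmxBl -!scalemxAl !mxE.
  by move: vCE vDE; rewrite !mxE => <- <-; rewrite mulrC subrr.
suff : L v = 0 by rewrite Lv => /eqP; rewrite oner_eq0.
have -> : L v = \sum_b (w 0 b * \sum_a c a *: bdry F 0 b a)@_mD.
  rewrite vE /L.
  under eq_bigr => a _ do rewrite mxE linear_sum mulr_suml.
  rewrite exchange_big /=; apply: eq_bigr => b _.
  rewrite mulr_sumr linear_sum /=; apply: eq_bigr => a _.
  by rewrite -scalerAr mcoeffZ mulrC.
(* A nonzero term requires a variable in the [C]-coordinate of row [b] that divides the monomial of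
   [D]. *)
rewrite big1 // => b _; apply/eqP; rewrite mcoeff_eq0.
apply/negP => /msuppM_le/allpairsP[[m1 m2] /= [_ m2s mDE]].
have : (\sum_a c a *: bdry F 0 b a)@_m2 != 0 by rewrite -mcoeff_msupp.
case/negP; apply/eqP; rewrite linear_sum /=.
have hom_db a : bdry F 0 b a \is 1.-homog.
  by have := hom_d 0%N b a; rewrite !shiftF addSn subSn // subnn; apply.
have [k m2k] : exists k, m2 = U_(k)%MM.
  have hom_s : \sum_a c a *: bdry F 0 b a \is 1.-homog.
    by apply: rpred_sum => a _; rewrite dhomogZ.
  have /dhomogP/(_ m2 m2s)/eqP := hom_s; rewrite /= mdeg_eq1 => /existsP[k /eqP->].
  by exists k.
have := (ker_aug (row b (bdry F 0))).2 (ex_intro _ _ (rowE _ _)).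
(* Row [b] is a syzygy, and its coefficient at [U_(k) + mC] turns out to be the sum in question. *)
move/rowP/(_ 0)/(congr1 (mcoeff (U_(k) + mC)%MM)); rewrite !mxE mcoeff0 linear_sum /= => ker_b.
rewrite m2k -[RHS]ker_b; apply: eq_bigr => a _; rewrite mxE mcoeffZ mulrC.
rewrite mcoeffM_unique // => m /aug_supp[E tE ->] le.
have Dk : enum_val k \in D.
  have := congr1 (fun m : 'X_{1..#|V|} => m k) mDE; rewrite mnmE mnmDE m2k mnm1E eqxx.
  by case: (_ \in D) => //; rewrite addn1.
have sE : E \subset enum_val k |: C.
  apply/subsetP => x Ex; have /mnm_lepP/(_ (enum_rank x)) := le.
  rewrite mnmDE !set_mnmE Ex mnm1E !inE.
  have [->|_] := eqVneq k (enum_rank x); first by rewrite enum_rankK eqxx.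
  by rewrite add0n; case: (x \in C); rewrite ?orbT.
have sCD : enum_val k |: C \subset C :|: D by rewrite subUset sub1set inE Dk orbT subsetUl.
(* The case [E = D] would place [D] inside a single vertex, against [2 <= t]. *)
have [-> //|ED] := ind E tE (subset_trans sE sCD).
suff : (#|D| <= 1)%N by case/andP: tD => /eqP-> _; rewrite leqNgt t2.
rewrite -(cards1 (enum_val k)); apply: subset_leq_card; apply/subsetP => x Dx.
have := subsetP sE x; rewrite ED Dx => /(_ isT); rewrite !inE => /orP[//|Cx].
by have := disjointFr disj Cx; rewrite Dx.
Qed.

Lemma tgap_free_linear_quotients : irreflexive e -> chordal e ->
  (0 < t)%N -> tgap_free e t -> has_linear_quotients (tconnected_ideal K e t).
Proof.
move=> e_irr chord t0 gf.
have [q q_pe] := chordal_perfect_elimination e_sym e_irr chord.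
(* Heavier sets come first, so that the exchanged set, heavier than [D], precedes [D]. *)
pose ge C D := (weight q D <= weight q C)%N.
pose L := sort ge (enum [set C | tconnected e t C]).
have memL C : (C \in L) = tconnected e t C by rewrite mem_sort mem_enum inE.
have uniqL : uniq L by rewrite sort_uniq enum_uniq.
have ge_trans : transitive ge by move=> x y z; rewrite /ge => yx xz; apply: leq_trans xz yx.
have sortedL : sorted ge L by apply: sort_sorted => C D; apply: leq_total.
have geL i j : (i <= j < size L)%N -> ge (nth set0 L i) (nth set0 L j).
  move=> /andP[ij jL].
  by apply: (sorted_leq_nth ge_trans _ set0 sortedL);
    rewrite ?inE ?(leq_ltn_trans ij) // => x; apply: leqnn.
pose u := [seq set_mnm C | C <- L].
have szu : size u = size L by rewrite size_map.
have uE m : m \in u -> exists2 C, tconnected e t C & m = set_mnm C.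
  by case/mapP => C CL ->; exists C; rewrite // -memL.
have Iu : same_ideal (tconnected_ideal K e t) (monomial_ideal u).
  move=> p; rewrite tconnected_idealP monomial_idealP; split=> supp m /supp [].
    by move=> C tC le; exists (set_mnm C); rewrite // map_f // memL.
  by move=> _ /uE[C tC ->] le; exists C.
have cardt E : tconnected e t E -> mdeg (set_mnm E) = t.
  by rewrite mdeg_set_mnm => /andP[/eqP].
exists u.
  split=> // [|v vu Iv m mu]; first by rewrite map_inj_uniq //; apply: set_mnm_inj.
  have [m' m'v le] : exists2 m', m' \in v & (m' <= m)%MM.
    apply/(monomial_ideal_X K)/Iv/tconnected_ideal_X.
    by have [C tC ->] := uE m mu; exists C; rewrite ?lepm_refl.
  suff <- : m' = m by [].
  apply: lepm_mdeg_eq le _; have [C tC ->] := uE m mu.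
  by have [C' tC' ->] := uE m' (vu _ m'v); rewrite !cardt.
suff lqu : linear_quotient_seq u.
  by move=> i /andP[_ ltiu]; apply: linear_quotient_seq_colon.
move=> i j /andP[ij]; rewrite szu => jL; have iL := ltn_trans ij jL.
rewrite !(nth_map set0) //; set C := nth set0 L i; set D := nth set0 L j.
have tC : tconnected e t C by rewrite -memL mem_nth.
have tD : tconnected e t D by rewrite -memL mem_nth.
have ltw : (weight q D < weight q C)%N.
  have leDC : (weight q D <= weight q C)%N by apply: geL; rewrite (ltnW ij).
  rewrite ltn_neqAle leDC andbT.
  apply/negP => /eqP/(weight_inj q_pe)/eqP; rewrite nth_uniq // => /eqP ji.
  by rewrite ji ltnn in ij.
have [[/eqP cC conC] [/eqP cD conD]] := (andP tC, andP tD).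
have conCD := tgap_free_connected_setU e_sym t0 gf tC tD.
have [|v [w [Cv nDv Dw conE ltE]]] := connected_exchange e_sym e_irr q_pe conC conD conCD _ ltw.
  by rewrite cC cD.
set E := v |: D :\ w in conE ltE.
have EL : E \in L.
  rewrite memL /tconnected conE andbT cardsU1 !inE (negbTE nDv) andbF /=.
  by rewrite -cD (cardsD1 w D) Dw.
(* The monomial of [E] divides that of [D] times the variable of the entering vertex [v]. *)
exists (index E L), (enum_rank v); split.
- rewrite ltnNge; apply/negP => jE; have := geL j (index E L).
  by rewrite jE index_mem EL nth_index // /ge leqNgt ltE => /(_ isT).
- rewrite (nth_map set0) ?index_mem // nth_index //; apply/mnm_lepP => k.
  rewrite mnmDE mnm1E -[k]enum_valK !set_mnmE (inj_eq enum_rank_inj) !inE eq_sym.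
  by case: (v == _) => //; case: (_ \in D); rewrite ?andbF ?leq_b1.
by rewrite !set_mnmE Cv (negbTE nDv).
Qed.

End TConnectedIdeal.

Theorem theorem5p1 (K : fieldType) (V : finType) (e : rel V)
    (e_sym : symmetric e) (e_irr : irreflexive e)
    (e_chordal : chordal e) (t : nat) (t_ge2 : (2 <= t)%N) :
  (has_linear_quotients (tconnected_ideal K e t) <->
     has_linear_resolution t (tconnected_ideal K e t)) /\
  (has_linear_resolution t (tconnected_ideal K e t) <->
     tgap_free e t).
Proof.
have ab := @tconnected_linear_resolution K V e t.
have bc := @linear_resolution_tgap_free K V e t t_ge2.
have ca := @tgap_free_linear_quotients K V e t e_sym e_irr e_chordal (ltnW t_ge2).
split; split=> //; first by move=> /bc/ca.
by move=> /ca/ab.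
Qed.
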